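(* Let $A_N\xi=\sum_{j=0}^N a(j)\xi(j)$ with complex coefficients $a(0),\dots,a(N)$. Let $\Xi$ be the class of (wide sense) stationary stochastic sequences $\xi=\{\xi(j),j\in\mathbb Z\}$ satisfying $E\xi(j)=0$, $E|\xi(j)|^2\le P$, where $P>0$ is given. Let $\Lambda$ be the class of all linear estimates $\hat A_N\xi$ of the functional $A_N\xi$ based on observations of $\xi(j)$ at the points $j=-1,-2,\dots$, and let $\Delta(\xi,\hat A_N)=E|A_N\xi-\hat A_N\xi|^2$. Then the function $\Delta(\xi,\hat A_N)$ has a saddle point on the set $\Xi\times\Lambda$, and $$\min_{\hat A_N\in\Lambda}\max_{\xi\in\Xi}\Delta(\xi,\hat A_N)=\max_{\xi\in\Xi}\min_{\hat A_N\in\Lambda}\Delta(\xi,\hat A_N)=P\nu_N^2 .$$ The least favourable sequence in the class $\Xi$ for the optimal linear estimation of the functional $A_N\xi$ is the one-sided moving average sequence of order $N$ determined by the formula $$\xi(j)=\sum_{u=j-N}^{j}\varphi(j-u)\,\varepsilon(u).$$ Here $\nu_N^2$ is the largest eigenvalue of the selfadjoint compact operator $Q_N$ in the space $\mathbb C^{N+1}$ determined by the matrix $Q_N=\{Q_N(p,q)\}_{p,q=0}^N$ with elements $$Q_N(p,q)=\sum_{u=0}^{\min(N-p,N-q)}a(p+u)\,\overline{a(q+u)},\qquad p,q=0,1,\dots,N;$$ $\varepsilon(u)$ is a stationary stochastic sequence with orthogonal values, $E\varepsilon(i)\overline{\varepsilon(j)}=\delta_{ij}$; and $\{\varphi(u),\,u=0,\dots,N\}$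 is determined by the eigenvector that corresponds to $\nu_N^2$ and the condition $\|\xi(j)\|^2=P$.
   Context: A sequence of complex valued random variables $\xi(j)$, $j\in\mathbb Z$, with finite second moments is wide sense stationary if its mean is constant and the covariance of $\xi(k+n)$ and $\xi(k)$ does not depend on $k$. $\|\xi(j)\|^2=E|\xi(j)|^2$, and $\delta_{ij}$ is the Kronecker symbol. The problem is viewed as a two-person zero-sum game: the first player chooses $\xi\in\Xi$ to maximize the mean square error $\Delta$, the second chooses a linear estimate $\hat A_N\in\Lambda$ to minimize it; a saddle point is an equilibrium point of this game. The least favourable sequence is the sequence in $\Xi$ that gives the maximum error, i.e. at which $\max_{\xi\in\Xi}\min_{\hat A_N\in\Lambda}\Delta(\xi,\hat A_N)$ is attained. *)

(* Defs.v *)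
(* MathComp / MathComp-Analysis *)
From HB Require Import structures.
From mathcomp Require Export all_boot all_order all_algebra.
From mathcomp Require Export complex.
From mathcomp Require Export all_classical all_reals all_analysis.

Set Implicit Arguments.
Unset Strict Implicit.
Unset Printing Implicit Defensive.

Import Order.TTheory GRing.Theory Num.Theory.
Import numFieldNormedType.Exports.

Local Open Scope classical_set_scope.
Local Open Scope ring_scope.
Local Open Scope complex_scope.

(* The library has no measurable structure on R[i]; it is given
   componentwise. *)
Definition cmeasurable (R : realType) (d : measure_display)
    (T : measurableType d) (X : T -> R[i]) : Prop :=
  measurable_fun [set: T] (fun w => complex.Re (X w)) /\
  measurable_fun [set: T] (fun w => complex.Im (X w)).

(* E|X|^2; here `|X w| : R[i] has imaginary part 0. *)
Definition msq (R : realType) (d : measure_display) (T : measurableType d)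
    (Pr : probability T R) (X : T -> R[i]) : \bar R :=
  'E_Pr[fun w => complex.Re (`|X w| ^+ 2)].

(* Only meaningful when X is integrable, which is the case for all the
   variables below since they have finite second moments. *)
Definition cexp (R : realType) (d : measure_display) (T : measurableType d)
    (Pr : probability T R) (X : T -> R[i]) : R[i] :=
  (fine 'E_Pr[fun w => complex.Re (X w)])
    +i* (fine 'E_Pr[fun w => complex.Im (X w)]).

Definition ccov (R : realType) (d : measure_display) (T : measurableType d)
    (Pr : probability T R) (X Y : T -> R[i]) : R[i] :=
  cexp Pr (fun w => (X w - cexp Pr X) * (Y w - cexp Pr Y)^*).

Definition wide_sense_stationary (R : realType) (d : measure_display)
    (T : measurableType d) (Pr : probability T R)
    (xi : int -> T -> R[i]) : Prop :=
  [/\ forall j, cmeasurable (xi j) /\ (msq Pr (xi j) < +oo)%E,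
      forall j k, cexp Pr (xi j) = cexp Pr (xi k) &
      forall n k l, ccov Pr (xi (k + n)) (xi k) = ccov Pr (xi (l + n)) (xi l)].

Definition Xi (R : realType) (d : measure_display) (T : measurableType d)
    (Pr : probability T R) (P : R) : set (int -> T -> R[i]) :=
  [set xi | [/\ wide_sense_stationary Pr xi,
                forall j, cexp Pr (xi j) = 0 &
                forall j, (msq Pr (xi j) <= P%:E)%E]].

Definition stationary_orthonormal (R : realType) (d : measure_display)
    (T : measurableType d) (Pr : probability T R)
    (eps : int -> T -> R[i]) : Prop :=
  wide_sense_stationary Pr eps /\
  forall i j, cexp Pr (fun w => eps i w * (eps j w)^*) = (i == j)%:R.

(* sum_(j <= N) a(j) xi(j) *)
Definition functional (R : realType) (d : measure_display)
    (T : measurableType d) (N : nat) (a : nat -> R[i])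
    (xi : int -> T -> R[i]) : T -> R[i] :=
  fun w => \sum_(j < N.+1) a j * xi j%:Z w.

(* c`_0 xi(-1) + c`_1 xi(-2) + ... *)
Definition past_comb (R : realType) (d : measure_display)
    (T : measurableType d) (c : seq R[i]) (xi : int -> T -> R[i])
    : T -> R[i] :=
  fun w => \sum_(k < size c) c`_k * xi (- (k.+1)%:Z) w.

(* A linear estimate is a rule that does not depend on xi: a sequence of finite
   families of weights.  Its value at xi is the mean square limit of the
   corresponding finite linear combinations of xi(-1), xi(-2), ...  Hence the
   values at a given xi of all linear estimates form exactly the closed linear
   span of xi(-1), xi(-2), ... *)
Definition linear_estimate (R : realType) : Type := nat -> seq R[i].

Definition Lambda (R : realType) : set (linear_estimate R) := [set: _].
Arguments Lambda : clear implicits.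

Definition estimate_value (R : realType) (d : measure_display)
    (T : measurableType d) (Pr : probability T R) (h : linear_estimate R)
    (xi : int -> T -> R[i]) (Y : T -> R[i]) : Prop :=
  cmeasurable Y /\
  (fun n => msq Pr (fun w => past_comb (h n) xi w - Y w)) @ \oo --> 0%E.

(* The mean square limit is unique up to almost sure equality, so the infimum
   is over a single number when the limit exists; when it does not, the
   infimum is over the empty set and the error is +oo. *)
Definition Delta (R : realType) (d : measure_display) (T : measurableType d)
    (Pr : probability T R) (N : nat) (a : nat -> R[i])
    (xi : int -> T -> R[i]) (h : linear_estimate R) : \bar R :=
  ereal_inf [set msq Pr (fun w => functional N a xi w - Y w)
            | Y in estimate_value Pr h xi].

(* The first player (xi) maximizes, the second player (h) minimizes. *)
Definition saddle_point (R : realType) (A B : Type) (D : A -> B -> \bar R)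
    (X : set A) (L : set B) (xi0 : A) (h0 : B) : Prop :=
  [/\ X xi0, L h0, (forall xi, X xi -> (D xi h0 <= D xi0 h0)%E) &
      forall h, L h -> (D xi0 h0 <= D xi0 h)%E].

Definition worst_error (R : realType) (A B : Type) (D : A -> B -> \bar R)
    (X : set A) (h : B) : \bar R := ereal_sup [set D xi h | xi in X].

Definition least_error (R : realType) (A B : Type) (D : A -> B -> \bar R)
    (L : set B) (xi : A) : \bar R := ereal_inf [set D xi h | h in L].

Definition is_minimum (R : realType) (S : set (\bar R)) (v : \bar R) : Prop :=
  S v /\ lbound S v.

Definition is_maximum (R : realType) (S : set (\bar R)) (v : \bar R) : Prop :=
  S v /\ ubound S v.

Definition least_favourable (R : realType) (A B : Type)
    (D : A -> B -> \bar R) (X : set A) (L : set B) (xi0 : A) : Prop :=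
  X xi0 /\
  is_maximum [set least_error D L xi | xi in X] (least_error D L xi0).

Definition Q (R : realType) (N : nat) (a : nat -> R[i]) : 'M[R[i]]_N.+1 :=
  \matrix_(p < N.+1, q < N.+1)
    \sum_(u < (minn (N - p) (N - q)).+1) a (p + u)%N * (a (q + u)%N)^*.

Definition largest_eigenvalue (R : realType) (n : nat) (M : 'M[R[i]]_n)
    (x : R) : Prop :=
  eigenvalue M x%:C /\ forall z : R[i], eigenvalue M z -> z <= x%:C.

(* sum_(u = j - N)^j phi(j - u) eps(u), reindexed by k = j - u *)
Definition moving_average (R : realType) (d : measure_display)
    (T : measurableType d) (N : nat) (phi : 'rV[R[i]]_N.+1)
    (eps : int -> T -> R[i]) : int -> T -> R[i] :=
  fun j w => \sum_(k < N.+1) phi 0 k * eps (j - k%:Z) w.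

(* eigenspace consists of row vectors: phi *m Q = x phi.  In terms of a column
   eigenvector v of Q (Q v = x v, v <> 0), phi is a multiple of the conjugate
   of v, as Q is Hermitian.  The conjugate is needed: the moving average with
   coefficients phi has minimal error at least
   sum_k |sum_u a(k + u) phi(u)|^2 = phi *m Q *m phi^*. *)
Definition determined_by_eigenvector (R : realType) (d : measure_display)
    (T : measurableType d) (Pr : probability T R) (N : nat) (a : nat -> R[i])
    (x P : R) (eps : int -> T -> R[i]) (phi : 'rV[R[i]]_N.+1) : Prop :=
  (phi <= eigenspace (Q N a) x%:C)%MS /\
  forall j, msq Pr (moving_average phi eps j) = P%:E.

(* Main.v *)
Require Import Defs.
From mathcomp Require Import spectral measurable_realfun zify ring lra.
Set Implicit Arguments.
Unset Strict Implicit.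
Unset Printing Implicit Defensive.
Import Order.TTheory GRing.Theory Num.Theory numFieldNormedType.Exports.
Local Open Scope classical_set_scope.
Local Open Scope ring_scope.
Local Open Scope complex_scope.

(* Write X^k for xi(N - k). The error of a finite combination of xi(-1), xi(-2), ... is then
   given by a polynomial F - X^(N+1) H with F = sum_k a(N - k) X^k, and phi Q_N phi^* is the
   squared norm of the first N+1 coefficients of F Phi. Hence nu^2 is the squared norm of
   multiplication by F modulo X^(N+1), and Schur's algorithm (the Caratheodory-Fejer problem)
   yields p, q with p = q F modulo X^(N+1), with |p| <= |nu| |q| and with q free of zeros in
   the closed unit disc. The algorithm uses only one algebraic identity, valid for every
   positive sesquilinear form that the shift contracts, so no spectral representation is
   needed: the bound holds directly for the covariance form of every stationary sequence.
   Expanding p / q as a Neumann series produces a single estimate whose error is at most P nu^2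
   against every xi. Conversely, for the moving average with coefficients phi the errors of
   finite combinations are the squared norms of the coefficients of (F - X^(N+1) H) Phi, and
   the first N+1 of these already give phi Q_N phi^* = P nu^2. *)

(** * The squared modulus of a complex number *)

Definition sqn (R : realType) (z : R[i]) : R :=
  complex.Re z ^+ 2 + complex.Im z ^+ 2.

Section SquaredModulus.
Variable R : realType.
Implicit Types z w : R[i].

Lemma sqn_ge0 z : 0 <= sqn z.
Proof. by rewrite addr_ge0 ?sqr_ge0. Qed.

Lemma sqnE z : sqn z = complex.Re (z * z^*).
Proof. by case: z => a b; rewrite /sqn /=; ring. Qed.

Lemma sqnC z : (sqn z)%:C = z * z^*.
Proof. by case: z => a b; apply/eqP; rewrite eq_complex /sqn /=; apply/andP; split; apply/eqP;
  ring. Qed.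

Lemma sqnM z w : sqn (z * w) = sqn z * sqn w.
Proof. by case: z w => a b [c e]; rewrite /sqn /=; ring. Qed.

Lemma sqnJ z : sqn z^* = sqn z.
Proof. by case: z => a b; rewrite /sqn /=; ring. Qed.

Lemma sqnN z : sqn (- z) = sqn z.
Proof. by case: z => a b; rewrite /sqn /=; ring. Qed.

Lemma sqn_real (x : R) : sqn x%:C = x ^+ 2.
Proof. by rewrite /sqn /=; ring. Qed.

Lemma sqn0 : sqn (0 : R[i]) = 0.
Proof. by rewrite /sqn /=; ring. Qed.

Lemma sqn1 : sqn (1 : R[i]) = 1.
Proof. by rewrite /sqn /=; ring. Qed.

Lemma sqn_eq0 z : (sqn z == 0) = (z == 0).
Proof.
by case: z => a b; rewrite /sqn eq_complex /= paddr_eq0 ?sqr_ge0 // !sqrf_eq0.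
Qed.

End SquaredModulus.

(** * Positive sesquilinear forms on polynomials that are contracted by the shift *)

Record shift_form (R : realType)
    (B : {poly R[i]} -> {poly R[i]} -> R[i]) : Prop := ShiftForm {
  form_linear : forall c u v w, B (c *: u + v) w = c * B u w + B v w;
  form_conj : forall u v, B v u = (B u v)^*;
  form_ge0 : forall u, 0 <= complex.Re (B u u);
  form_shift : forall u, complex.Re (B ('X * u) ('X * u)) <= complex.Re (B u u) }.

Definition sqnorm (R : realType) (B : {poly R[i]} -> {poly R[i]} -> R[i]) u : R :=
  complex.Re (B u u).
Definition fnorm (R : realType) (B : {poly R[i]} -> {poly R[i]} -> R[i]) u : R :=
  Num.sqrt (sqnorm B u).

Section ShiftForm.
Variables (R : realType) (B : {poly R[i]} -> {poly R[i]} -> R[i]).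
Hypothesis HB : shift_form B.
Implicit Types u v w : {poly R[i]}.
Local Notation n2 := (sqnorm B).
Local Notation nm := (fnorm B).

Lemma form0 w : B 0 w = 0.
Proof.
have := form_linear HB 1 0 0 w; rewrite scale1r addr0 mul1r => /eqP.
by rewrite -subr_eq0 opprD addrA subrr sub0r oppr_eq0 => /eqP.
Qed.

Lemma formD u v w : B (u + v) w = B u w + B v w.
Proof. by rewrite -{1}[u]scale1r (form_linear HB) mul1r. Qed.

Lemma formZ c u w : B (c *: u) w = c * B u w.
Proof. by rewrite -[c *: u]addr0 (form_linear HB) form0 addr0. Qed.

Lemma sqnormD u v : n2 (u + v) = n2 u + n2 v + 2 * complex.Re (B u v).
Proof.
rewrite /sqnorm formD (form_conj HB (u + v) u) (form_conj HB (u + v) v) !formD.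
rewrite [B v u](form_conj HB).
case: (B u u) (B v v) (B u v) => a b [c e] [f g] /=; ring.
Qed.

Lemma sqnormZ c u : n2 (c *: u) = sqn c * n2 u.
Proof.
have : complex.Im (B u u) = 0.
  have := form_conj HB u u; case: (B u u) => a b /= [] /eqP.
  by rewrite -addr_eq0 -mulr2n mulrn_eq0 /= => /eqP.
rewrite /sqnorm formZ (form_conj HB (c *: u)) formZ /sqn.
by case: c (B u u) => a b [e f] /= ->; ring.
Qed.

(** The identity that drives Schur's algorithm. The cross terms of both squares are the real part of
    [2 * g * B u w], so they cancel, and only the diagonal terms remain. *)
Lemma form_schur g u w :
  n2 (u + g^* *: w) - n2 (g *: u + w) = (1 - sqn g) * (n2 u - n2 w).
Proof.
rewrite !sqnormD !sqnormZ sqnJ formZ (form_conj HB (g^* *: w)) formZ.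
rewrite [B w u](form_conj HB) /sqn.
case: g (B u w) => a b [c e] /=; ring.
Qed.

Lemma sqnorm_ge0 u : 0 <= n2 u. Proof. exact: form_ge0. Qed.

Lemma fnorm_ge0 u : 0 <= nm u. Proof. exact: sqrtr_ge0. Qed.

Lemma fnorm_sqr u : nm u ^+ 2 = n2 u.
Proof. by rewrite sqr_sqrtr ?sqnorm_ge0. Qed.

Lemma fnormZ c u : nm (c *: u) = Num.sqrt (sqn c) * nm u.
Proof. by rewrite /fnorm sqnormZ sqrtrM ?sqn_ge0. Qed.

Lemma fnormN u : nm (- u) = nm u.
Proof. by rewrite -scaleN1r /fnorm sqnormZ sqnN sqn1 mul1r. Qed.

Lemma fnorm_shift u : nm ('X * u) <= nm u.
Proof. by rewrite ler_wsqrtr // (form_shift HB). Qed.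

Lemma form_CS u v : complex.Re (B u v) <= nm u * nm v.
Proof.
(* The form may be degenerate, so the norms are enlarged by e to make them positive; this allows
   division by their product. *)
suff H e : 0 < e -> complex.Re (B u v) <= (nm u + e) * (nm v + e).
  apply/ler_addgt0Pr => e e0.
  have s0 : 0 < nm u + nm v + 1 + e by have := fnorm_ge0 u; have := fnorm_ge0 v; lra.
  have d0 : 0 < e / (nm u + nm v + 1 + e) by rewrite divr_gt0.
  apply: (le_trans (H _ d0)).
  (* As d <= 1, the product with both norms enlarged by d exceeds the product of the norms by at
     most d times their sum plus one, hence by at most e. *)
  set d := e / _ in d0 *.
  have d1 : d <= 1.
    by rewrite /d ler_pdivrMr // mul1r; have := fnorm_ge0 u; have := fnorm_ge0 v; lra.
  have -> : e = d * (nm u + nm v + 1 + e) by rewrite /d divfK ?gt_eqF.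
  by have := fnorm_ge0 u; have := fnorm_ge0 v; nra.
move=> e0.
set x := nm u + e; set y := nm v + e.
have x0 : 0 < x by have := fnorm_ge0 u; rewrite /x; lra.
have y0 : 0 < y by have := fnorm_ge0 v; rewrite /y; lra.
(* Expanding the square of y u - x v and bounding the norms by x and y leaves 2xy (xy - Re B(u, v))
   >= 0. *)
have := sqnorm_ge0 (y%:C *: u + (- x%:C) *: v).
rewrite sqnormD !sqnormZ sqnN !sqn_real formZ (form_conj HB (_ *: v)) formZ.
rewrite -!fnorm_sqr [B v u](form_conj HB).
have := fnorm_ge0 u; have := fnorm_ge0 v.
have hx : nm u <= x by rewrite /x; lra.
have hy : nm v <= y by rewrite /y; lra.
case: (B u v) => a b /= v0 u0.
have h1 : y ^+ 2 * nm u ^+ 2 <= y ^+ 2 * x ^+ 2.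
  by rewrite ler_wpM2l ?sqr_ge0 // ler_sqr ?nnegrE // ltW.
have h2 : x ^+ 2 * nm v ^+ 2 <= x ^+ 2 * y ^+ 2.
  by rewrite ler_wpM2l ?sqr_ge0 // ler_sqr ?nnegrE // ltW.
move=> h3.
have : 0 <= (x * y) * (x * y - a) by nra.
by rewrite pmulr_rge0 ?subr_ge0 // mulr_gt0.
Qed.

Lemma fnormD u v : nm (u + v) <= nm u + nm v.
Proof.
rewrite -ler_sqr ?nnegrE ?addr_ge0 ?fnorm_ge0 //.
rewrite fnorm_sqr sqnormD -!fnorm_sqr.
by have := form_CS u v; nra.
Qed.

Lemma fnormB u v : nm (u - v) <= nm u + nm v.
Proof. by rewrite (le_trans (fnormD _ _)) // fnormN. Qed.

Lemma fnorm_sum (I : Type) (r : seq I) (F : I -> {poly R[i]}) :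
  nm (\sum_(i <- r) F i) <= \sum_(i <- r) nm (F i).
Proof.
elim: r => [|i r IH]; last by rewrite !big_cons (le_trans (fnormD _ _)) // lerD2l.
by rewrite !big_nil /fnorm /sqnorm form0 /= sqrtr0.
Qed.

Lemma fnorm_shiftn k u : nm ('X^k * u) <= nm u.
Proof.
elim: k => [|k IH]; first by rewrite expr0 mul1r.
by rewrite exprS -mulrA (le_trans (fnorm_shift _)).
Qed.

Lemma fnorm_mul q u : nm (q * u) <= (\sum_(i < size q) Num.sqrt (sqn q`_i)) * nm u.
Proof.
rewrite -{1}[q]coefK poly_def mulr_suml (le_trans (fnorm_sum _ _)) // mulr_suml.
apply: ler_sum => i _; rewrite -scalerAl fnormZ ler_wpM2l ?fnorm_shiftn //.
Qed.

End ShiftForm.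

(** * Truncated Toeplitz contractions and Schur's algorithm *)

Section CoefForm.
Variable R : realType.
Implicit Types u v w : {poly R[i]}.

Definition coef_form n u v : R[i] := \sum_(i < n) u`_i * (v`_i)^*.

Lemma sqnorm_coef n u : sqnorm (coef_form n) u = \sum_(i < n) sqn u`_i.
Proof. by rewrite /sqnorm raddf_sum; apply: eq_bigr => i _; rewrite sqnE. Qed.

Lemma sqnorm_coefX n u :
  sqnorm (coef_form n.+1) ('X * u) = sqnorm (coef_form n) u.
Proof.
rewrite !sqnorm_coef big_ord_recl coefXM /= sqn0 add0r.
by apply: eq_bigr => i _; rewrite coefXM.
Qed.

(** The shift pushes the top coefficient out of the truncation, so it contracts without being
    isometric. *)
Lemma coef_formP n : shift_form (coef_form n).
Proof.
split=> [c u v w|u v|u|u].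
- rewrite /coef_form mulr_sumr -big_split; apply: eq_bigr => i _ /=.
  by rewrite coefD coefZ mulrDl mulrA.
- rewrite /coef_form rmorph_sum; apply: eq_bigr => i _ /=.
  by rewrite rmorphM /= conjcK mulrC.
- by have := sqnorm_coef n u; rewrite /sqnorm => ->; apply: sumr_ge0 => i _; exact: sqn_ge0.
- case: n => [|n]; first by rewrite /coef_form !big_ord0.
  have -> : complex.Re (coef_form n.+1 ('X * u) ('X * u)) = sqnorm (coef_form n.+1) ('X * u)
    by [].
  rewrite sqnorm_coefX sqnorm_coef [X in _ <= X](sqnorm_coef n.+1 u) big_ord_recr /=.
  by rewrite lerDl sqn_ge0.
Qed.

Lemma sqnorm_coef_congr n u v : 'X^n %| u - v ->
  sqnorm (coef_form n) u = sqnorm (coef_form n) v.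
Proof.
case/dvdpP => r /eqP; rewrite subr_eq => /eqP ->.
by rewrite !sqnorm_coef; apply: eq_bigr => i _; rewrite coefD coefMXn ltn_ord add0r.
Qed.

Definition point_form (z : R[i]) u v : R[i] := u.[z] * (v.[z])^*.

Lemma sqnorm_point z u : sqnorm (point_form z) u = sqn u.[z].
Proof. by rewrite sqnE. Qed.

(** Evaluation at a point of the closed unit disc is the instance through which Schur's algorithm
    keeps q free of zeros there. *)
Lemma point_formP z : sqn z <= 1 -> shift_form (point_form z).
Proof.
move=> hz; split=> [c u v w|u v|u|u].
- by rewrite /point_form hornerD hornerZ mulrDl mulrA.
- by rewrite /point_form rmorphM /= conjcK mulrC.
- by rewrite -sqnE sqn_ge0.
- by rewrite -!sqnE hornerM hornerX sqnM ler_piMl ?sqn_ge0.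
Qed.

(* That is, the lower triangular n x n Toeplitz matrix of the coefficients of F
   is a contraction. *)
Definition toeplitz_contraction n (F : {poly R[i]}) :=
  forall x, sqnorm (coef_form n) (F * x) <= sqnorm (coef_form n) x.

Lemma inverse_mod_Xn n (A : {poly R[i]}) : A.[0] != 0 ->
  exists D, 'X^n %| D * A - 1.
Proof.
move=> A0; have /Bezout_eq1_coprimepP [[r s] /= rs] : coprimep A 'X^n.
  by rewrite coprimep_expr // coprimepX.
by exists r; rewrite -rs opprD addrA subrr sub0r dvdpNr dvdp_mull.
Qed.

(* F1 = (F - g) / (X (1 - g^* F)) modulo X^n, with g = F(0). *)
Lemma schur_step n (F F1 : {poly R[i]}) : let g := F`_0 in sqn g < 1 ->
  toeplitz_contraction n.+1 F ->
  'X^(n.+1) %| F - g%:P - 'X * F1 * (1 - g^* *: F) ->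
  toeplitz_contraction n F1.
Proof.
move=> g g1 hF hF1 y.
have [D hD] : exists D, 'X^(n.+1) %| D * (1 - g^* *: F) - 1.
  apply: inverse_mod_Xn; rewrite hornerD hornerN hornerZ hornerC -{1}/g.
  rewrite horner_coef0 -/g mulrC -sqnC subr_eq0 eq_complex /= eqxx andbT.
  by rewrite gt_eqF.
(* Both sides depend on y modulo X^n only, and after truncation the norms over n and n+1
   coefficients agree. *)
set y' := take_poly n y.
have Xy : 'X^n %| y - y'.
  by rewrite -{1}[y](poly_take_drop n) addrAC subrr add0r dvdp_mull.
rewrite (sqnorm_coef_congr Xy) (@sqnorm_coef_congr n _ (F1 * y')); last first.
  by rewrite -mulrBr dvdp_mull.
(* Here x solves (1 - conj(g) F) x = y' modulo X^(n+1). Hence y' is x - conj(g) F x and X F1 y' is F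
   x - g x, and [form_schur] with u = x, w = - F x reduces the claim to the contraction property of
   F at x. *)
set x := D * y'.
have e1 : 'X^(n.+1) %| x + g^* *: (- (F * x)) - y'.
  have -> : x + g^* *: (- (F * x)) - y' = (D * (1 - g^* *: F) - 1) * y'.
    by rewrite /x -mul_polyC -[g^* *: F]mul_polyC; ring.
  by rewrite dvdp_mulr.
have e2 : 'X^(n.+1) %| 'X * (F1 * y') - - (g *: x + - (F * x)).
  have -> : 'X * (F1 * y') - - (g *: x + - (F * x)) =
    - (F - g%:P - 'X * F1 * (1 - g^* *: F)) * x - (D * (1 - g^* *: F) - 1) * ('X * F1 * y').
    by rewrite /x -mul_polyC -[g^* *: F]mul_polyC; ring.
  by rewrite dvdp_sub ?dvdp_mulr // dvdpNr.
have HB := coef_formP n.+1.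
rewrite -sqnorm_coefX (sqnorm_coef_congr e2).
have -> : sqnorm (coef_form n) y' = sqnorm (coef_form n.+1) y'.
  by rewrite !sqnorm_coef big_ord_recr /= coef_take_poly ltnn sqn0 addr0.
rewrite -(sqnorm_coef_congr e1) -scaleN1r sqnormZ // sqnN sqn1 mul1r.
rewrite -subr_ge0 form_schur // mulr_ge0 ?subr_ge0 ?(ltW g1) //.
by rewrite -scaleN1r sqnormZ // sqnN sqn1 mul1r.
Qed.

(** Induction along the Schur parameters: a solution p, q for F1 is carried to one for F by the
    Moebius transformation with parameter g = F(0). The bound of p by q survives by [form_schur]
    with u = q v and w = X p v, since the shift contracts. *)
Lemma schur_algorithm n (F : {poly R[i]}) : toeplitz_contraction n F ->
  exists p q, [/\ 'X^n %| p - q * F,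
    forall B, shift_form B -> forall v, sqnorm B (p * v) <= sqnorm B (q * v) &
    forall z, sqn z <= 1 -> q.[z] != 0].
Proof.
elim: n F => [|n IH] F hF.
  exists 0, 1; split=> [|B HB v|z _]; last by rewrite hornerC oner_neq0.
    by rewrite expr0 dvd1p.
  by rewrite mul0r {1}/sqnorm form0 // sqnorm_ge0.
set g := F`_0.
(* The contraction is tested on the constant polynomial 1. *)
have : \sum_(i < n.+1) sqn F`_i <= 1.
  have := hF 1; rewrite mulr1 !sqnorm_coef => /le_trans; apply.
  rewrite big_ord_recl coef1 /= sqn1 big1 ?addr0 // => i _.
  by rewrite coef1 /= sqn0.
rewrite big_ord_recl /= -/g => hg.
have hs i : 0 <= sqn F`_i by exact: sqn_ge0.
(* If |g| >= 1, the bound on the coefficients leaves no room for the others: F is congruent to the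
   constant g, and the recursion stops with p = g, q = 1. *)
have [g1|g1] := ltP (sqn g) 1; last first.
  have F0 i : (i < n)%N -> F`_i.+1 = 0.
    move=> lin; apply/eqP; rewrite -sqn_eq0 eq_le hs andbT.
    have : \sum_(j < n) sqn F`_(lift ord0 j) <= 0 by lra.
    apply: le_trans; rewrite (bigD1 (Ordinal lin)) //=.
    by rewrite lerDl sumr_ge0.
  exists g%:P, 1; split=> [|B HB v|z _]; last by rewrite hornerC oner_neq0.
    rewrite mul1r; apply/dvdpP; exists (- drop_poly n.+1 F).
    apply/polyP => i; rewrite mulNr coefN coefMXn coefB coefC.
    case: ltnP => hi; last first.
      by rewrite coef_drop_poly subnK //; case: i hi => [//|i _]; rewrite sub0r.
    by case: i hi => [|i] hi; rewrite oppr0 /= ?/g ?subrr // sub0r F0 ?oppr0.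
  rewrite mul_polyC sqnormZ // mul1r ler_piMl ?sqnorm_ge0 //.
  have : 0 <= \sum_(j < n) sqn F`_(lift ord0 j) by rewrite sumr_ge0.
  by lra.
have [D hD] : exists D, 'X^(n.+1) %| D * (1 - g^* *: F) - 1.
  apply: inverse_mod_Xn; rewrite hornerD hornerN hornerZ hornerC.
  rewrite horner_coef0 -/g mulrC -sqnC subr_eq0 eq_complex /= eqxx andbT.
  by rewrite gt_eqF.
have FE : F - g%:P = 'X * drop_poly 1 F.
  rewrite -{1}[F](poly_take_drop 1) expr1 [in LHS]addrAC mulrC.
  suff -> : take_poly 1 F = g%:P by rewrite subrr add0r.
  by apply/polyP => -[|i]; rewrite coef_take_poly coefC.
have hF1 : 'X^(n.+1) %| F - g%:P - 'X * (drop_poly 1 F * D) * (1 - g^* *: F).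
  rewrite FE.
  have -> : 'X * drop_poly 1 F - 'X * (drop_poly 1 F * D) * (1 - g^* *: F) =
    (D * (1 - g^* *: F) - 1) * - ('X * drop_poly 1 F) by ring.
  by rewrite dvdp_mulr.
set F1 := drop_poly 1 F * D in hF1.
have [p [q [pq hpq hq]]] := IH F1 (schur_step g1 hF hF1).
(* This is the inverse of F1 = (F - g) / (X (1 - conj(g) F)), with F1 replaced by p / q. *)
exists (g *: q + 'X * p), (q + g^* *: ('X * p)); split.
- have -> : g *: q + 'X * p - (q + g^* *: ('X * p)) * F =
    - q * (F - g%:P - 'X * F1 * (1 - g^* *: F)) +
    'X * (p - q * F1) * (1 - g^* *: F).
    by rewrite -!mul_polyC; ring.
  apply: dvdp_add; first exact: dvdp_mull.
  by apply: dvdp_mulr; rewrite exprS dvdp_mul2l ?polyX_eq0.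
- move=> B HB v.
  rewrite !mulrDl -!scalerAl -subr_ge0 form_schur // mulr_ge0 ?subr_ge0 ?(ltW g1) //.
  by rewrite (le_trans _ (hpq B HB v)) // -mulrA; exact: form_shift.
(* At a zero z of the new denominator, q(z) = - conj(g) z p(z). Then p(z) is nonzero because q(z)
   is, and |p(z)| <= |q(z)| = |g| |z| |p(z)| < |p(z)|, which is absurd. *)
move=> z hz; apply: contraTneq isT => /eqP.
rewrite hornerD hornerZ hornerM hornerX addr_eq0 => /eqP qE.
have := hpq _ (point_formP hz) 1; rewrite !mulr1 !sqnorm_point.
rewrite {1}qE sqnN sqnM sqnJ sqnM => h.
have q0 : 0 < sqn q.[z] by rewrite lt_def sqn_ge0 sqn_eq0 hq.
have p0 : 0 < sqn p.[z].
  move: q0; rewrite qE sqnN sqnM sqnM => q0; rewrite lt_def sqn_ge0 andbT.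
  by apply: contraTneq q0 => ->; rewrite !mulr0 ltxx.
suff : sqn g * (sqn z * sqn p.[z]) < sqn p.[z] by rewrite ltNge h.
have := sqn_ge0 g; have := sqn_ge0 z; move: hz g1.
set s := sqn z; set t := sqn g; set r := sqn p.[z] in p0 * => s1 t1 s0 t0.
have : s * t < 1 by nra.
by nra.
Qed.

End CoefForm.

(** * Polynomial approximants of p / q, uniform over all forms *)

Section Approximants.
Variable R : realType.
Implicit Types q F : {poly R[i]}.

(* w is a truncated power series of 1 / q; the remainder e is small in all forms
   at once. *)
Definition nearly_invertible q := forall r : R, 0 < r -> exists w e : {poly R[i]},
  q * w = 1 - e /\
  forall B, shift_form B -> forall u : {poly R[i]}, fnorm B (e * u) <= r * fnorm B u.

Lemma nearly_invertibleC (c : R[i]) : c != 0 -> nearly_invertible c%:P.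
Proof.
move=> c0 r r0; exists (c^-1)%:P, 0; split; first by rewrite -polyCM divff // subr0.
move=> B HB u; rewrite mul0r {1}/fnorm {1}/sqnorm form0 //= sqrtr0.
by rewrite mulr_ge0 ?fnorm_ge0 // ltW.
Qed.

Lemma nearly_invertibleM q1 q2 :
  nearly_invertible q1 -> nearly_invertible q2 -> nearly_invertible (q1 * q2).
Proof.
move=> h1 h2 r r0.
(* The new remainder e1 + e2 - e1 e2 has three terms; each contributes at most s, where s <= 1 is
   used for the product. *)
set s := Num.min (r / 3) 1.
have s0 : 0 < s by rewrite lt_min divr_gt0 //= ltr01.
have s1 : s <= 1 by rewrite ge_min lexx orbT.
have sr : s * 3 <= r by rewrite -ler_pdivlMr // ge_min lexx.
have [w1 [e1 [E1 B1]]] := h1 s s0.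
have [w2 [e2 [E2 B2]]] := h2 s s0.
exists (w1 * w2), (e1 + e2 - e1 * e2); split.
  by rewrite mulrACA E1 E2; ring.
move=> B HB u.
rewrite mulrBl mulrDl.
have := B1 B HB u; have := B2 B HB u; have := B1 B HB (e2 * u); rewrite mulrA.
have := fnormB HB (e1 * u + e2 * u) (e1 * e2 * u).
have := fnormD HB (e1 * u) (e2 * u).
have := fnorm_ge0 B u; have := fnorm_ge0 B (e2 * u).
set x := fnorm B _; set y := fnorm B u; set z := fnorm B (e1 * e2 * u).
set t := fnorm B (e1 * u); set v := fnorm B (_ + _); set k := fnorm B (_ - _).
move=> x0 y0 h3 h4 h5 h6 h7.
have : s * x <= x by rewrite ler_piMl.
have : s * y * 3 <= r * y by rewrite mulrAC ler_wpM2r.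
by lra.
Qed.

(** Geometric series for 1 / (X - z) in powers of X / z. The remainder (X / z)^m has norm at most
    |z|^(-m) in every form, because X contracts. *)
Lemma nearly_invertible_XsubC (z : R[i]) : 1 < sqn z ->
  nearly_invertible ('X - z%:P).
Proof.
move=> z1 r r0.
have z0 : z != 0 by rewrite -sqn_eq0; apply: lt0r_neq0; apply: lt_trans z1.
have sz : sqn z^-1 = (sqn z)^-1.
  have : sqn z * sqn z^-1 = 1 by rewrite -sqnM divff // sqn1.
  by move=> h; apply: (mulfI (_ : sqn z != 0)); rewrite ?sqn_eq0 // h divff ?sqn_eq0.
have [m hm] : exists m, (sqn z)^-1 ^+ m < r ^+ 2.
  have /cvg_expr /cvgrPdist_lt /(_ (r ^+ 2)) : `|(sqn z)^-1| < 1.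
    by rewrite ger0_norm ?invr_ge0 ?sqn_ge0 // invf_lt1 // (lt_trans _ z1).
  rewrite exprn_gt0 // => /(_ isT) [m _ /(_ m (leqnn m))] /=.
  rewrite sub0r normrN ger0_norm ?exprn_ge0 ?invr_ge0 ?sqn_ge0 // => h.
  by exists m.
exists (- (z^-1)%:P * \sum_(i < m) ((z^-1)%:P * 'X) ^+ i), (((z^-1)%:P * 'X) ^+ m); split.
  rewrite mulrA -[1 - _]opprB subrX1 -mulNr; congr (_ * _).
  have : z%:P * (z^-1)%:P = 1 :> {poly R[i]} by rewrite -polyCM divff.
  rewrite mulrN mulrBl => ->; rewrite mulrC opprB; ring.
move=> B HB u.
rewrite exprMn -polyC_exp -mulrA mul_polyC fnormZ //.
apply: ler_pM; rewrite ?sqrtr_ge0 ?fnorm_ge0 ?fnorm_shiftn //.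
rewrite -[leRHS]ger0_norm ?(ltW r0) // -sqrtr_sqr ler_wsqrtr //.
suff -> : sqn (z^-1 ^+ m) = (sqn z)^-1 ^+ m by rewrite ltW.
by elim: (m) => [|k IH]; rewrite ?expr0 ?sqn1 // !exprS sqnM IH sz.
Qed.

(** Over the complex numbers q splits into a nonzero constant and factors X - z with |z| > 1, and
    near invertibility is multiplicative. *)
Lemma nearly_invertibleP q : (forall z, sqn z <= 1 -> q.[z] != 0) ->
  nearly_invertible q.
Proof.
move=> hq; have [rs qE] := closed_field_poly_normal q.
have lq : lead_coef q != 0.
  rewrite lead_coef_eq0; apply: contraTneq (hq 0 _) => [->|]; first by rewrite horner0 eqxx.
  by rewrite sqn0.
have hrs : all (fun z => 1 < sqn z) rs.
  apply/allP => z zrs; rewrite ltNge; apply: contraTN isT => /hq.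
  have : root q z by rewrite qE rootZ // root_prod_XsubC.
  by rewrite /root => ->.
rewrite qE -mul_polyC; apply: nearly_invertibleM; first exact: nearly_invertibleC.
elim: rs hrs {qE} => [_|z rs IH /= /andP[z1 h]].
  by rewrite big_nil; apply: nearly_invertibleC; rewrite oner_neq0.
by rewrite big_cons; apply: nearly_invertibleM; [exact: nearly_invertible_XsubC | exact: IH].
Qed.

Lemma coef_le_fnorm n F i : (i < n)%N ->
  Num.sqrt (sqn F`_i) <= fnorm (@coef_form R n) F.
Proof.
move=> lin; rewrite ler_wsqrtr // sqnorm_coef (bigD1 (Ordinal lin)) //=.
by rewrite lerDl sumr_ge0 // => j _; exact: sqn_ge0.
Qed.

(** Passes from the coefficient form to an arbitrary form B. Every monomial has B-norm at most that
    of 1, so B enters the constant only through the norm of 1. *)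
Lemma fnorm_take B n F : shift_form B ->
  fnorm B (take_poly n F) <= n%:R * fnorm (@coef_form R n) F * fnorm B 1.
Proof.
move=> HB; rewrite -[X in fnorm B X]mulr1 (le_trans (fnorm_mul HB _ _)) //.
rewrite ler_wpM2r ?fnorm_ge0 //.
apply: (@le_trans _ _ (\sum_(i < size (take_poly n F)) fnorm (@coef_form R n) F)).
  apply: ler_sum => i _; rewrite coef_take_poly ifT ?coef_le_fnorm //;
    exact: leq_trans (ltn_ord i) (size_take_poly _ _).
rewrite sumr_const card_ord -[fnorm _ _ *+ _]mulr_natl ler_wpM2r ?fnorm_ge0 //.
by rewrite ler_nat size_take_poly.
Qed.

(* G k = p w (1 + e + ... + e^(k-1)) tends to p / q, and - H k collects its terms
   of degree at least n. *)
Lemma approximants_contraction n F : toeplitz_contraction n F -> (size F <= n)%N ->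
  exists (H : nat -> {poly R[i]}) (K : R), forall B, shift_form B -> forall k,
    fnorm B (F - 'X^n * H k) <= (1 + K * 2^-1 ^+ k) * fnorm B 1 /\
    fnorm B ('X^n * (H k.+1 - H k)) <= K * 2^-1 ^+ k * fnorm B 1.
Proof.
move=> hF sF; have [p [q [pq hpq hq]]] := schur_algorithm hF.
have h2 : (0 : R) < 2^-1 by rewrite invr_gt0.
have [w [e [qw he]]] := nearly_invertibleP hq h2.
pose G k := p * (w * \sum_(i < k) e ^+ i).
pose C := n%:R * fnorm (@coef_form R n) F.
have hek B (HB : shift_form B) k u : fnorm B (e ^+ k * u) <= 2^-1 ^+ k * fnorm B u.
  elim: k => [|k IH]; first by rewrite !expr0 !mul1r.
  by rewrite exprS -mulrA (le_trans (he B HB _)) // exprS -mulrA ler_wpM2l.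
have qG k : q * (w * \sum_(i < k) e ^+ i) = 1 - e ^+ k.
  by rewrite mulrA qw -opprB mulNr -subrX1 opprB.
(* Modulo X^n, F e^k agrees with F - G k, because p = q F there. So subtracting from F the high part
   of - [G k] leaves [G k] up to a truncated error of order e^k. *)
have GE k : F - 'X^n * (- drop_poly n (G k)) = G k + take_poly n (F * e ^+ k).
  have : take_poly n (F * e ^+ k) = take_poly n (F - G k).
    suff : 'X^n %| F * e ^+ k - (F - G k).
      case/dvdpP => r /eqP; rewrite subr_eq => /eqP ->.
      by rewrite [LHS]take_polyD take_polyMXn_0 add0r.
    have -> : F * e ^+ k - (F - G k) = (p - q * F) * (w * \sum_(i < k) e ^+ i).
      rewrite mulrBl -/(G k) [q * F]mulrC -[F * q * _]mulrA qG; ring.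
    by rewrite dvdp_mulr.
  move=> ->; rewrite [take_poly n (F - _)]raddfB /= (take_poly_id sF).
  rewrite -{2}[G k](poly_take_drop n); ring.
(* The error exceeds 1 by at most (1 + C) 2^(-k), and the increment is at most (3/2) (1 + C) 2^(-k);
   the constant 2 + 2C covers both. *)
exists (fun k => - drop_poly n (G k)), (2 + 2 * C) => B HB k.
have hT j : fnorm B (take_poly n (F * e ^+ j)) <= C * 2^-1 ^+ j * fnorm B 1.
  rewrite (le_trans (fnorm_take _ _ HB)) // ler_wpM2r ?fnorm_ge0 // /C -mulrA ler_wpM2l //.
  by rewrite [F * _]mulrC mulrC [leRHS]mulrC mulrC hek //; exact: coef_formP.
have hG u : fnorm B (p * u) <= fnorm B (q * u) by rewrite ler_wsqrtr // hpq.
have d0 : 0 <= 2^-1 ^+ k :> R by rewrite exprn_ge0.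
have C0 : 0 <= C by rewrite mulr_ge0 ?sqrtr_ge0.
have n0 := fnorm_ge0 B 1.
have h1 := hek B HB k 1; rewrite mulr1 in h1.
split.
  rewrite GE (le_trans (fnormD HB _ _)) //.
  have := hG (w * \sum_(i < k) e ^+ i); rewrite -/(G k) qG.
  have := fnormB HB 1 (e ^+ k); have := hT k.
  have : 0 <= C * 2^-1 ^+ k * fnorm B 1 by rewrite !mulr_ge0 ?fnorm_ge0.
  have : 0 <= 2^-1 ^+ k * fnorm B 1 by rewrite !mulr_ge0 ?fnorm_ge0.
  by lra.
have -> : 'X^n * (- drop_poly n (G k.+1) - - drop_poly n (G k)) =
  (p * (w * e ^+ k) * -1) + (take_poly n (F * e ^+ k) - take_poly n (F * e ^+ k.+1)).
  transitivity ((F - 'X^n * - drop_poly n (G k)) - (F - 'X^n * - drop_poly n (G k.+1))).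
    ring.
  by rewrite !GE /G big_ord_recr /=; ring.
rewrite (le_trans (fnormD HB _ _)) // mulrN1 fnormN //.
have := fnormB HB (take_poly n (F * e ^+ k)) (take_poly n (F * e ^+ k.+1)).
have := hT k; have := hT k.+1; have := hG (w * e ^+ k).
have -> : q * (w * e ^+ k) = e ^+ k - e ^+ k.+1.
  by rewrite mulrA qw mulrBl mul1r exprS.
have := hek B HB k.+1 1; rewrite mulr1.
have := fnormB HB (e ^+ k) (e ^+ k.+1).
rewrite [2^-1 ^+ k.+1]exprS.
have : 0 <= C * 2^-1 ^+ k * fnorm B 1 by rewrite !mulr_ge0 ?fnorm_ge0.
have : 0 <= 2^-1 ^+ k * fnorm B 1 by rewrite !mulr_ge0 ?fnorm_ge0.
by lra.
Qed.

(** Rescaling F by 1 / nu gives a contraction. For nu = 0, testing on 1 shows F = 0, and zero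
    approximants suffice. *)
Lemma approximants n F (nu : R) : 0 <= nu -> (size F <= n)%N ->
  (forall x, sqnorm (@coef_form R n) (F * x) <= nu ^+ 2 * sqnorm (@coef_form R n) x) ->
  exists (H : nat -> {poly R[i]}) (K : R), forall B, shift_form B -> forall k,
    fnorm B (F - 'X^n * H k) <= (nu + K * 2^-1 ^+ k) * fnorm B 1 /\
    fnorm B ('X^n * (H k.+1 - H k)) <= K * 2^-1 ^+ k * fnorm B 1.
Proof.
move=> nu0 sF hF; have [nuE|nu_neq0] := eqVneq nu 0.
  suff -> : F = 0.
    exists (fun=> 0), 0 => B HB k; rewrite !(mulr0, subr0, subrr, mul0r, addr0).
    by rewrite /fnorm /sqnorm form0 //= sqrtr0 mulr_ge0 ?sqrtr_ge0.
  apply/polyP => i; rewrite coef0; have [hi|hi] := ltnP i n; last first.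
    by rewrite nth_default // (leq_trans sF).
  have := hF 1; rewrite nuE expr0n mul0r mulr1 sqnorm_coef (bigD1 (Ordinal hi)) //= => h.
  apply/eqP; rewrite -sqn_eq0 eq_le sqn_ge0 andbT (le_trans _ h) // lerDl.
  by rewrite sumr_ge0 // => j _; exact: sqn_ge0.
have nup : 0 < nu by rewrite lt_def nu_neq0.
have [|//|H [K hHK]] := @approximants_contraction n (nu^-1%:C *: F).
- move=> x; rewrite -scalerAl sqnormZ; last exact: coef_formP.
  rewrite sqn_real exprVn ler_pdivrMl ?exprn_gt0 //; exact: hF.
- by rewrite (leq_trans (size_scale_leq _ _)).
exists (fun k => nu%:C *: H k), (nu * K) => B HB k.
have nuC : sqn nu%:C = nu ^+ 2 by exact: sqn_real.
have [h1 h2] := hHK B HB k; split.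
  have -> : F - 'X^n * (nu%:C *: H k) = nu%:C *: (nu^-1%:C *: F - 'X^n * H k).
    by rewrite scalerBr scalerA -scalerAr -rmorphM /= divff // scale1r.
  rewrite fnormZ // nuC sqrtr_sqr ger0_norm //.
  by move: h1; rewrite -(ler_pM2l nup); lra.
rewrite -scalerBr -scalerAr fnormZ // nuC sqrtr_sqr ger0_norm // -!mulrA.
by rewrite ler_pM2l // mulrA.
Qed.

End Approximants.

(** * The matrix Q_N as the quadratic form of multiplication by the functional's polynomial *)

Section QuadraticForm.
Variables (R : realType) (N : nat) (a : nat -> R[i]).
Local Notation "M ^t*" := (map_mx (@Num.conj _) M^T) (at level 30).

(* The functional A_N xi in the indexing that is reversed in time: X^k stands
   for xi(N - k). *)
Definition functional_poly : {poly R[i]} := \poly_(k < N.+1) a (N - k).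

(** With its columns in reverse order this is, acting on row vectors, the matrix of multiplication
    by [functional_poly] modulo X^(N+1). *)
Definition hankel_mx : 'M[R[i]]_N.+1 :=
  \matrix_(p, u) if (p + u <= N)%N then a (p + u) else 0.

Lemma Q_hankel : Q N a = hankel_mx *m hankel_mx^t*.
Proof.
apply/matrixP => p q; rewrite !mxE.
rewrite (big_ord_widen N.+1 (fun u => a (p + u)%N * (a (q + u)%N)^*)); last first.
  by rewrite ltnS geq_min leq_subr.
rewrite big_mkcond; apply: eq_bigr => u _; rewrite !mxE.
have lp := ltn_ord p; have lq := ltn_ord q; have lu := ltn_ord u.
have -> : (u < (minn (N - p) (N - q)).+1)%N = (p + u <= N)%N && (q + u <= N)%N by lia.
by case: (p + u <= N)%N; case: (q + u <= N)%N => /=; rewrite ?mul0r ?rmorph0 ?mulr0.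
Qed.

Lemma Q_normal : Q N a \is normalmx.
Proof.
apply/eqP; suff -> : (Q N a)^t* = Q N a by [].
by rewrite Q_hankel trmx_mul map_mxM trmxCK.
Qed.

Lemma mx11_mul_tr n (v : 'rV[R[i]]_n) : (v *m v^t*) 0 0 = (\sum_i sqn (v 0 i))%:C.
Proof.
by rewrite mxE rmorph_sum /=; apply: eq_bigr => i _; rewrite !mxE sqnC.
Qed.

(** By [Q_hankel] the left side is the squared norm of v times the Hankel matrix, whose entry N - u
    is the coefficient of X^u in the product. *)
Lemma Q_form (v : 'rV[R[i]]_N.+1) :
  (v *m Q N a *m v^t*) 0 0 =
  (sqnorm (@coef_form R N.+1) (functional_poly * rVpoly v))%:C.
Proof.
set M := hankel_mx.
have -> : v *m Q N a *m v^t* = (v *m M) *m (v *m M)^t*.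
  by rewrite Q_hankel trmx_mul map_mxM !mulmxA.
rewrite mx11_mul_tr.
rewrite sqnorm_coef; congr _%:C; rewrite (reindex_inj rev_ord_inj) /=.
apply: eq_bigr => u _; congr sqn; rewrite mxE coefMr.
have lu : (u <= N)%N by rewrite -ltnS.
rewrite (big_ord_widen N.+1 (fun j => functional_poly`_(u - j) * (rVpoly v)`_j)) //.
rewrite [RHS]big_mkcond; apply: eq_bigr => j _; rewrite !mxE coef_rVpoly_ord.
have -> : (rev_ord u = N - u :> nat)%N by rewrite /= subSS.
have lj : (j <= N)%N by rewrite -ltnS.
case: (leqP j u) => ju.
  rewrite /functional_poly coef_poly !ifT; try by lia.
  by rewrite mulrC; congr (a _ * _); lia.
by rewrite !ifF ?mulr0 //; lia.
Qed.

(** The rows of the spectral matrix are eigenvectors, so each diagonal entry is an eigenvalue and at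
    most x. In that orthonormal basis the two sides compare coordinate by coordinate. *)
Lemma Q_form_le (x : R) (v : 'rV[R[i]]_N.+1) : largest_eigenvalue (Q N a) x ->
  (v *m Q N a *m v^t*) 0 0 <= x%:C * (v *m v^t*) 0 0.
Proof.
case=> _ hx; set P := spectralmx (Q N a); set sp := spectral_diag (Q N a).
have Pu : P \is unitarymx by exact: spectral_unitarymx.
have QE : Q N a = P^t* *m diag_mx sp *m P.
  by rewrite -invmx_unitary //; exact/orthomx_spectralP/Q_normal.
have hsp i : sp 0 i <= x%:C.
  apply: hx; apply/eigenvalueP; exists (row i P).
    rewrite -row_mul {1}QE !mulmxA (unitarymxP Pu) mul1mx row_mul.
    by rewrite row_diag_mx -scalemxAl -rowE.
  apply/eqP => ri0; have /row_freeP [M] : row_free P by rewrite row_free_unit unitarymx_unit.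
  move=> /(congr1 (row i)); rewrite row_mul ri0 mul0mx => /matrixP /(_ 0 i).
  by rewrite !mxE eqxx => /eqP; rewrite eq_sym oner_eq0.
set y := v *m P^t*.
have -> : v *m v^t* = y *m y^t*.
  rewrite /y trmx_mul map_mxM trmxCK mulmxA -[v *m _ *m P]mulmxA.
  by rewrite -invmx_unitary // mulVmx ?unitarymx_unit // mulmx1.
have -> : v *m Q N a *m v^t* = y *m diag_mx sp *m y^t*.
  by rewrite /y trmx_mul map_mxM trmxCK {1}QE !mulmxA.
rewrite !mxE mulr_sumr; apply: ler_sum => i _.
rewrite mul_mx_diag !mxE mulrAC mulrC.
by rewrite ler_wpM2r // mulcJ_ge0.
Qed.

Lemma functional_poly_contraction (x : R) : largest_eigenvalue (Q N a) x ->
  forall u, sqnorm (@coef_form R N.+1) (functional_poly * u)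
            <= x * sqnorm (@coef_form R N.+1) u.
Proof.
move=> hx u.
have du : 'X^(N.+1) %| u - take_poly N.+1 u.
  by rewrite -{1}[u](poly_take_drop N.+1) addrAC subrr add0r dvdp_mull.
rewrite (sqnorm_coef_congr du) (@sqnorm_coef_congr _ _ _ (functional_poly * take_poly N.+1
  u)); last first.
  by rewrite -mulrBr dvdp_mull.
have -> : take_poly N.+1 u = rVpoly (poly_rV (take_poly N.+1 u) : 'rV_N.+1).
  by rewrite poly_rV_K // size_take_poly.
move: (poly_rV _) => v.
have := Q_form_le v hx; rewrite Q_form mx11_mul_tr -rmorphM /= lecE /= => /andP[_].
rewrite sqnorm_coef [in X in _ -> X]sqnorm_coef; congr (_ <= x * _).
by apply: eq_bigr => i _; rewrite coef_rVpoly_ord.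
Qed.

(** The equality case of [functional_poly_contraction], attained at the eigenvectors of the largest
    eigenvalue. *)
Lemma functional_poly_eigen (x : R) (v : 'rV[R[i]]_N.+1) :
  (v <= eigenspace (Q N a) x%:C)%MS ->
  sqnorm (@coef_form R N.+1) (functional_poly * rVpoly v) = x * \sum_i sqn (v 0 i).
Proof.
move=> /eigenspaceP vQ; have := Q_form v.
by rewrite vQ -scalemxAl mxE mx11_mul_tr -rmorphM /= => -[].
Qed.

End QuadraticForm.

(** * Mean square norms of complex random variables *)

Section MeanSquare.
Context {R : realType} {d : measure_display} {T : measurableType d}.
Variable Pr : probability T R.
Implicit Types X Y : T -> R[i].

Lemma cmeasurableD X Y : cmeasurable X -> cmeasurable Y ->
  cmeasurable (fun w => X w + Y w).
Proof.
move=> [X1 X2] [Y1 Y2]; split.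
  apply: (eq_measurable_fun (fun w => complex.Re (X w) + complex.Re (Y w)));
    last exact: measurable_funD.
  by move=> w _; rewrite raddfD.
apply: (eq_measurable_fun (fun w => complex.Im (X w) + complex.Im (Y w)));
  last exact: measurable_funD.
by move=> w _; rewrite raddfD.
Qed.

Lemma cmeasurableM X Y : cmeasurable X -> cmeasurable Y ->
  cmeasurable (fun w => X w * Y w).
Proof.
move=> [X1 X2] [Y1 Y2]; split.
  apply: (eq_measurable_fun (fun w => complex.Re (X w) * complex.Re (Y w) - complex.Im (X w)
    * complex.Im (Y w))).
    by move=> w _; case: (X w) (Y w) => ? ? [].
  by apply: measurable_funB; apply: measurable_funM.
apply: (eq_measurable_fun (fun w => complex.Re (X w) * complex.Im (Y w) + complex.Im (X w) *
  complex.Re (Y w))).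
  by move=> w _; case: (X w) (Y w) => ? ? [].
by apply: measurable_funD; apply: measurable_funM.
Qed.

Lemma cmeasurableJ X : cmeasurable X -> cmeasurable (fun w => (X w)^*).
Proof.
move=> [X1 X2]; split.
  by apply: (eq_measurable_fun (fun w => complex.Re (X w))) => // w _; case: (X w).
apply: (eq_measurable_fun (fun w => - complex.Im (X w))); last exact: measurable_funN.
by move=> w _; case: (X w).
Qed.

Lemma cmeasurable_cst (c : R[i]) : cmeasurable (fun _ : T => c).
Proof. by split; exact: measurable_cst. Qed.

Lemma measurable_sqn X : cmeasurable X ->
  measurable_fun [set: T] (fun w => (sqn (X w))%:E).
Proof.
move=> [X1 X2]; apply/measurable_EFinP; apply: measurable_funD.
  by apply: (eq_measurable_fun (fun w => complex.Re (X w) * complex.Re (X w))) => //;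
    exact: measurable_funM.
by apply: (eq_measurable_fun (fun w => complex.Im (X w) * complex.Im (X w))) => //;
  exact: measurable_funM.
Qed.

Lemma msqE X : msq Pr X = (\int[Pr]_w (sqn (X w))%:E)%E.
Proof.
rewrite /msq unlock; apply: eq_integral => w _; congr EFin.
by rewrite sqr_normc sqnE.
Qed.

Lemma eq_msq X Y : X =1 Y -> msq Pr X = msq Pr Y.
Proof. by move=> XY; rewrite !msqE; apply: eq_integral => w _; rewrite XY. Qed.

Lemma msq_ge0 X : (0 <= msq Pr X)%E.
Proof. by rewrite msqE integral_ge0 // => w _; rewrite lee_fin sqn_ge0. Qed.

Lemma msqZ (c : R[i]) X : cmeasurable X ->
  msq Pr (fun w => c * X w) = ((sqn c)%:E * msq Pr X)%E.
Proof.
move=> mX; rewrite !msqE -ge0_integralZl_EFin ?sqn_ge0 //; first last.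
- exact: measurable_sqn.
- by move=> w _; rewrite lee_fin sqn_ge0.
by apply: eq_integral => w _; rewrite sqnM EFinM.
Qed.

(** The parameter t stays free because its optimal value is what produces the sharp constant in
    Minkowski's inequality. *)
Lemma sqnD_le (t : R) (z w : R[i]) : 0 < t ->
  sqn (z + w) <= (1 + t) * sqn z + (1 + t^-1) * sqn w.
Proof.
move=> t0; case: z w => a b [c e]; rewrite /sqn /=.
have tK : t * t^-1 = 1 by rewrite divff // gt_eqF.
have s0 : 0 < t^-1 by rewrite invr_gt0.
have h x y : 2 * x * y <= t * x ^+ 2 + t^-1 * y ^+ 2.
  have : 0 <= t^-1 * (t * x - y) ^+ 2 by rewrite mulr_ge0 ?sqr_ge0 // ltW.
  have -> : t^-1 * (t * x - y) ^+ 2 = (t * t^-1) * (t * x ^+ 2) - 2 * (t * t^-1) * x * y +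
    t^-1 * y ^+ 2 by ring.
  by rewrite tK; lra.
by have := h a c; have := h b e; lra.
Qed.

Lemma msqD_le (t : R) X Y : 0 < t -> cmeasurable X -> cmeasurable Y ->
  (msq Pr (fun w => X w + Y w)%R
   <= (1 + t)%:E * msq Pr X + (1 + t^-1)%:E * msq Pr Y)%E.
Proof.
move=> t0 mX mY.
have t1 : 0 <= 1 + t by rewrite addr_ge0 // ltW.
have t2 : 0 <= 1 + t^-1 by rewrite addr_ge0 // invr_ge0 ltW.
have sX w : (0 <= (sqn (X w))%:E)%E by rewrite lee_fin sqn_ge0.
have sY w : (0 <= (sqn (Y w))%:E)%E by rewrite lee_fin sqn_ge0.
rewrite !msqE -!ge0_integralZl_EFin //; try exact: measurable_sqn.
rewrite -ge0_integralD //; first last.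
- by apply: measurable_funeM; exact: measurable_sqn.
- by move=> w _; rewrite mule_ge0.
- by apply: measurable_funeM; exact: measurable_sqn.
- by move=> w _; rewrite mule_ge0.
apply: ge0_le_integral => //.
- by move=> w _; rewrite lee_fin sqn_ge0.
- by apply: measurable_sqn; exact: cmeasurableD.
- by apply: emeasurable_funD; apply: measurable_funeM; exact: measurable_sqn.
- by move=> w _; rewrite -!EFinM -EFinD lee_fin sqnD_le.
Qed.

Definition square_integrable X := cmeasurable X /\ (msq Pr X < +oo)%E.

Lemma square_integrableD X Y : square_integrable X -> square_integrable Y ->
  square_integrable (fun w => X w + Y w).
Proof.
move=> [mX fX] [mY fY]; split; first exact: cmeasurableD.
apply: (le_lt_trans (msqD_le ltr01 mX mY)).
by apply: lte_add_pinfty; apply: lte_mul_pinfty; rewrite ?lee_fin.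
Qed.

Lemma square_integrableZ (c : R[i]) X : square_integrable X ->
  square_integrable (fun w => c * X w).
Proof.
move=> [mX fX]; split; first by apply: cmeasurableM => //; exact: cmeasurable_cst.
by rewrite msqZ //; apply: lte_mul_pinfty; rewrite ?lee_fin ?sqn_ge0.
Qed.

Lemma square_integrable_cst (c : R[i]) : square_integrable (fun=> c).
Proof.
split; first exact: cmeasurable_cst.
rewrite msqE integral_cst // [X in (_ * X)%E](_ : _ = 1%E) ?mule1 ?ltry //.
exact: probability_setT.
Qed.

Lemma square_integrableB X Y : square_integrable X -> square_integrable Y ->
  square_integrable (fun w => X w - Y w).
Proof.
move=> hX hY; have := square_integrableD hX (square_integrableZ (-1) hY).
by under [X in square_integrable X -> _]eq_fun do rewrite mulN1r.
Qed.

Lemma square_integrable_sum (I : Type) (r : seq I) (X : I -> T -> R[i]) :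
  (forall i, square_integrable (X i)) ->
  square_integrable (fun w => \sum_(i <- r) X i w).
Proof.
move=> hX; elim: r => [|i r IH].
  by under eq_fun do rewrite big_nil; exact: square_integrable_cst.
by under eq_fun do rewrite big_cons; exact: square_integrableD.
Qed.

(** Meaningful only for square integrable X: [fine] sends an infinite mean square to 0. *)
Definition rms X : R := Num.sqrt (fine (msq Pr X)).

Lemma rms_ge0 X : 0 <= rms X. Proof. exact: sqrtr_ge0. Qed.

Lemma msq_rms X : square_integrable X -> msq Pr X = (rms X ^+ 2)%:E.
Proof.
move=> [_ fX]; rewrite /rms sqr_sqrtr ?fine_ge0 ?msq_ge0 // fineK //.
by rewrite ge0_fin_numE // msq_ge0.
Qed.

Lemma eq_rms X Y : X =1 Y -> rms X = rms Y.
Proof. by move=> XY; rewrite /rms (eq_msq XY). Qed.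

(* Minkowski, by optimizing the parameter t of msqD_le *)
Lemma rmsD X Y : square_integrable X -> square_integrable Y ->
  rms (fun w => X w + Y w) <= rms X + rms Y.
Proof.
move=> hX hY; apply/ler_addgt0Pr => e e0.
have [x0 y0] := (rms_ge0 X, rms_ge0 Y).
(* The halves of e keep b and c positive, so that t = c / b makes sense; with this t the bound
   becomes exactly (b + c)^2. *)
set b := rms X + e / 2; set c := rms Y + e / 2.
have b0 : 0 < b by rewrite /b; lra.
have c0 : 0 < c by rewrite /c; lra.
have t0 : 0 < c / b by rewrite divr_gt0.
have := msqD_le t0 hX.1 hY.1.
rewrite (msq_rms (square_integrableD hX hY)) (msq_rms hX) (msq_rms hY).
rewrite -!EFinM -EFinD lee_fin invf_div => h.
have -> : rms X + rms Y + e = b + c by rewrite /b /c; lra.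
rewrite -ler_sqr ?nnegrE ?rms_ge0 ?(ltW (addr_gt0 b0 c0)) //.
apply: (le_trans h).
have hb : rms X ^+ 2 <= b ^+ 2 by rewrite lerXn2r ?nnegrE ?(ltW b0) // lerDl divr_ge0 // ltW.
have hc : rms Y ^+ 2 <= c ^+ 2 by rewrite lerXn2r ?nnegrE ?(ltW c0) // lerDl divr_ge0 // ltW.
have -> : (b + c) ^+ 2 = (1 + c / b) * b ^+ 2 + (1 + b / c) * c ^+ 2.
  by field; rewrite !gt_eqF.
by apply: lerD; rewrite ler_wpM2l // addr_ge0 // divr_ge0 // ltW.
Qed.

Lemma rmsN X : cmeasurable X -> rms (fun w => - X w) = rms X.
Proof.
move=> mX; rewrite (@eq_rms _ (fun w => -1 * X w)); last by move=> w; rewrite mulN1r.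
by rewrite /rms msqZ // sqnN sqn1 mul1e.
Qed.

Lemma rmsB X Y : square_integrable X -> square_integrable Y ->
  rms (fun w => X w - Y w) <= rms X + rms Y.
Proof.
move=> hX hY; rewrite -(rmsN hY.1); apply: rmsD => //.
have := square_integrableZ (-1) hY.
by under [X in square_integrable X -> _]eq_fun do rewrite mulN1r.
Qed.

End MeanSquare.

(** * Complex expectations and the covariance form of a sequence *)

Section Covariance.
Context {R : realType} {d : measure_display} {T : measurableType d}.
Variable Pr : probability T R.
Implicit Types X Y : T -> R[i].
Local Notation square_integrable := (square_integrable Pr).
Local Notation cexp := (cexp Pr).

Definition cintegrable X :=
  Pr.-integrable [set: T] (EFin \o (fun w => complex.Re (X w))) /\
  Pr.-integrable [set: T] (EFin \o (fun w => complex.Im (X w))).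

Lemma cexpE X : cexp X = (\int[Pr]_w complex.Re (X w)) +i* (\int[Pr]_w complex.Im (X w)).
Proof. by rewrite /cexp unlock. Qed.

Lemma eq_cexp X Y : X =1 Y -> cexp X = cexp Y.
Proof. by move=> XY; congr cexp; exact/funext. Qed.

Lemma cintegrableD X Y : cintegrable X -> cintegrable Y ->
  cintegrable (fun w => X w + Y w).
Proof.
move=> [X1 X2] [Y1 Y2]; split.
  apply: eq_integrable (integrableD measurableT X1 Y1) => // w _ /=.
  by rewrite -EFinD -raddfD.
apply: eq_integrable (integrableD measurableT X2 Y2) => // w _ /=.
by rewrite -EFinD -raddfD.
Qed.

Lemma cintegrableZ (c : R[i]) X : cintegrable X -> cintegrable (fun w => c * X w).
Proof.
move=> [X1 X2]; split.
  apply: eq_integrable (integrableB measurableT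
    (integrableZl measurableT (complex.Re c) X1) (integrableZl measurableT (complex.Im c)
      X2)) => // w _ /=.
  by rewrite -!EFinM -EFinB; case: c (X w) => ? ? [].
apply: eq_integrable (integrableD measurableT
  (integrableZl measurableT (complex.Re c) X2) (integrableZl measurableT (complex.Im c) X1))
    => // w _ /=.
by rewrite -!EFinM -EFinD; case: c (X w) => ? ? [].
Qed.

Lemma cintegrable_sum (I : Type) (r : seq I) (X : I -> T -> R[i]) :
  (forall i, cintegrable (X i)) -> cintegrable (fun w => \sum_(i <- r) X i w).
Proof.
move=> hX; elim: r => [|i r IH].
  rewrite (_ : (fun _ => _) = (fun=> 0)); last by apply/funext => w; rewrite big_nil.
  by split; exact: integrable0.
rewrite (_ : (fun _ => _) = (fun w => X i w + \sum_(j <- r) X j w));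
  last by apply/funext => w; rewrite big_cons.
exact: cintegrableD.
Qed.

Lemma cexpD X Y : cintegrable X -> cintegrable Y ->
  cexp (fun w => X w + Y w) = cexp X + cexp Y.
Proof.
move=> [X1 X2] [Y1 Y2]; rewrite !cexpE; apply/eqP; rewrite eq_complex /=.
rewrite -!RintegralD //; apply/andP; split; apply/eqP; apply: eq_Rintegral => w _;
  exact: raddfD.
Qed.

Lemma cexpZ (c : R[i]) X : cintegrable X -> cexp (fun w => c * X w) = c * cexp X.
Proof.
move=> [X1 X2]; rewrite !cexpE; case: c => a b; apply/eqP; rewrite eq_complex /=.
have iZ r f : Pr.-integrable [set: T] (EFin \o f) ->
    Pr.-integrable [set: T] (EFin \o (fun w => r * f w)).
  move=> h; apply: eq_integrable (integrableZl measurableT r h) => // w _ /=.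
rewrite -!RintegralZl // -RintegralB //; [|exact: iZ|exact: iZ].
rewrite -RintegralD //; [|exact: iZ|exact: iZ].
by apply/andP; split; apply/eqP; apply: eq_Rintegral => w _; case: (X w).
Qed.

Lemma cexpJ X : cintegrable X -> cexp (fun w => (X w)^*) = (cexp X)^*.
Proof.
move=> [X1 X2]; rewrite !cexpE; apply/eqP; rewrite eq_complex /=.
apply/andP; split; apply/eqP; first by apply: eq_Rintegral => w _; case: (X w).
rewrite -mulN1r -RintegralZl //; apply: eq_Rintegral => w _.
by case: (X w) => /= ? ?; rewrite mulN1r.
Qed.

Lemma cexp_sum (I : Type) (r : seq I) (X : I -> T -> R[i]) :
  (forall i, cintegrable (X i)) ->
  cexp (fun w => \sum_(i <- r) X i w) = \sum_(i <- r) cexp (X i).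
Proof.
move=> hX; elim: r => [|i r IH].
  rewrite big_nil cexpE; apply/eqP; rewrite eq_complex /=.
  by rewrite /Rintegral !integral0_eq ?eqxx // => w _; rewrite big_nil.
rewrite big_cons -IH -cexpD //; last exact: cintegrable_sum.
by apply: eq_cexp => w; rewrite big_cons.
Qed.

Lemma integrable_sqn X : square_integrable X ->
  Pr.-integrable [set: T] (fun w => (sqn (X w))%:E).
Proof.
move=> [mX fX]; apply/integrableP; split; first exact: measurable_sqn.
move: fX; rewrite msqE; congr (_ < _)%E; apply: eq_integral => w _.
by rewrite gee0_abs // lee_fin sqn_ge0.
Qed.

Lemma cintegrable_mulJ X Y : square_integrable X -> square_integrable Y ->
  cintegrable (fun w => X w * (Y w)^*).
Proof.
move=> hX hY.
have [m1 m2] := cmeasurableM hX.1 (cmeasurableJ hY.1).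
have iXY := integrableD measurableT (integrable_sqn hX) (integrable_sqn hY).
split; (apply: le_integrable iXY => //; first exact/measurable_EFinP) => w _ /=.
  rewrite lee_fin [leRHS]ger0_norm ?(addr_ge0 (sqn_ge0 (X w)) (sqn_ge0 (Y w))) //.
  case: (X w) (Y w) => a b [c e]; rewrite /sqn /= ler_norml.
  have := sqr_ge0 (a - c); have := sqr_ge0 (a + c); have := sqr_ge0 (b - e);
    have := sqr_ge0 (b + e).
  by move=> *; apply/andP; split; nra.
rewrite lee_fin [leRHS]ger0_norm ?(addr_ge0 (sqn_ge0 (X w)) (sqn_ge0 (Y w))) //.
case: (X w) (Y w) => a b [c e]; rewrite /sqn /= ler_norml.
have := sqr_ge0 (b - c); have := sqr_ge0 (b + c); have := sqr_ge0 (a - e);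
  have := sqr_ge0 (a + e).
by move=> *; apply/andP; split; nra.
Qed.

Lemma square_cintegrable X : square_integrable X -> cintegrable X.
Proof.
move=> hX; have := cintegrable_mulJ hX (square_integrable_cst Pr 1).
by rewrite (_ : (fun w => _) = X) //; apply/funext => w; rewrite rmorph1 mulr1.
Qed.

Lemma cexp_msq X : square_integrable X ->
  complex.Re (cexp (fun w => X w * (X w)^*)) = rms Pr X ^+ 2.
Proof.
move=> hX; rewrite /rms sqr_sqrtr ?fine_ge0 ?msq_ge0 // msqE cexpE /=.
by congr fine; apply: eq_integral => w _; rewrite sqnE.
Qed.

(* X^k is interpreted as the k-th variable of the sequence. *)
Definition lin (X : nat -> T -> R[i]) (u : {poly R[i]}) : T -> R[i] :=
  fun w => \sum_(k < size u) u`_k * X k w.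

Section Lin.
Variable X : nat -> T -> R[i].
Hypothesis hX : forall k, square_integrable (X k).
Implicit Types u v : {poly R[i]}.

Lemma lin_widen n u w : (size u <= n)%N -> lin X u w = \sum_(k < n) u`_k * X k w.
Proof.
move=> hn; rewrite /lin (big_ord_widen n (fun k => u`_k * X k w)) // big_mkcond.
by apply: eq_bigr => k _; case: ltnP => // hk; rewrite nth_default ?mul0r.
Qed.

Lemma linP c u v w : lin X (c *: u + v) w = c * lin X u w + lin X v w.
Proof.
pose n := maxn (size u) (size v).
have hu : (size u <= n)%N by rewrite leq_maxl.
have hv : (size v <= n)%N by rewrite leq_maxr.
have huv : (size (c *: u + v : {poly R[i]})%R <= n)%N.
  by rewrite (leq_trans (size_polyD _ _)) // geq_max hv (leq_trans (size_scale_leq _ _)).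
rewrite !(@lin_widen n) // mulr_sumr -big_split; apply: eq_bigr => k _ /=.
by rewrite coefD coefZ mulrDl mulrA.
Qed.

Lemma linB u v w : lin X (u - v) w = lin X u w - lin X v w.
Proof. by rewrite addrC -scaleN1r linP mulN1r addrC. Qed.

Lemma square_integrable_lin u : square_integrable (lin X u).
Proof. by apply: square_integrable_sum => k; exact: square_integrableZ. Qed.

Lemma lin_shift n u w :
  lin X ('X^n * u) w = \sum_(k < size u) u`_k * X (n + k) w.
Proof.
have su : (size ('X^n * u)%R <= n + size u)%N.
  rewrite (leq_trans (size_polyMleq _ _)) // size_polyXn; lia.
rewrite (lin_widen _ su) big_split_ord /= big1 ?add0r; last first.
  by move=> k _; rewrite coefXnM ltn_ord mul0r.
by apply: eq_bigr => k _; rewrite coefXnM ltnNge leq_addr /= addKn.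
Qed.

Lemma lin_sumZ (I : Type) (r : seq I) (c : I -> R[i]) (q : I -> {poly R[i]}) w :
  lin X (\sum_(i <- r) c i *: q i) w = \sum_(i <- r) c i * lin X (q i) w.
Proof.
elim: r => [|i r IH]; last by rewrite !big_cons linP IH.
by rewrite !big_nil /lin size_poly0 big_ord0.
Qed.

Definition lin_form u v : R[i] := cexp (fun w => lin X u w * (lin X v w)^*).

Lemma fnorm_lin u : fnorm lin_form u = rms Pr (lin X u).
Proof.
rewrite /fnorm /sqnorm cexp_msq; last exact: square_integrable_lin.
by rewrite sqrtr_sqr ger0_norm // rms_ge0.
Qed.

End Lin.

Lemma cexp_lin_mulJ (X Y : nat -> T -> R[i]) n m (u v : {poly R[i]}) :
  (forall k, square_integrable (X k)) -> (forall k, square_integrable (Y k)) ->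
  (size u <= n)%N -> (size v <= m)%N ->
  cexp (fun w => lin X u w * (lin Y v w)^*) = \sum_(k < n) \sum_(l < m)
    u`_k * (v`_l)^* * cexp (fun w => X k w * (Y l w)^*).
Proof.
move=> hX hY hu hv.
rewrite (@eq_cexp _ (fun w => \sum_(k < n) \sum_(l < m)
   u`_k * (v`_l)^* * (X k w * (Y l w)^*))); last first.
  move=> w; rewrite (lin_widen _ _ hu) (lin_widen _ _ hv) mulr_suml; apply: eq_bigr => k _.
  rewrite rmorph_sum mulr_sumr; apply: eq_bigr => l _ /=.
  by rewrite rmorphM /= mulrACA.
have hkl k l : cintegrable (fun w => X k w * (Y l w)^*) by exact: cintegrable_mulJ.
rewrite cexp_sum; last first.
  by move=> k; apply: cintegrable_sum => l; exact: cintegrableZ.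
apply: eq_bigr => k _; rewrite cexp_sum; last by move=> l; exact: cintegrableZ.
by apply: eq_bigr => l _; rewrite cexpZ.
Qed.

(** Shift-invariant covariances make multiplication by X an isometry of [lin_form], in particular a
    contraction. *)
Lemma lin_formP (X : nat -> T -> R[i]) :
  (forall k, square_integrable (X k)) ->
  (forall k l, cexp (fun w => X k.+1 w * (X l.+1 w)^*) = cexp (fun w => X k w * (X l w)^*)) ->
  shift_form (lin_form X).
Proof.
move=> hX hshift; split=> [c u v w|u v|u|u].
- rewrite /lin_form -cexpZ; last by apply: cintegrable_mulJ; exact: square_integrable_lin.
  rewrite -cexpD; first last.
  + by apply: cintegrable_mulJ; exact: square_integrable_lin.
  + by apply: cintegrableZ; apply: cintegrable_mulJ; exact: square_integrable_lin.
  by apply: eq_cexp => t; rewrite linP mulrDl mulrA.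
- rewrite /lin_form -cexpJ; last by apply: cintegrable_mulJ; exact: square_integrable_lin.
  by apply: eq_cexp => t; rewrite rmorphM /= conjcK mulrC.
- by rewrite cexp_msq ?sqr_ge0 //; exact: square_integrable_lin.
- suff -> : lin_form X ('X * u) ('X * u) = lin_form X u u by [].
  have s1 : (size ('X * u)%R <= (size u).+1)%N.
    by rewrite (leq_trans (size_polyMleq _ _)) // size_polyX.
  rewrite /lin_form (cexp_lin_mulJ hX hX s1 s1) (cexp_lin_mulJ hX hX (leqnn _) (leqnn _))
    big_ord_recl big1 ?add0r; last first.
    by move=> l _; rewrite coefXM mul0r mul0r.
  apply: eq_bigr => k _; rewrite big_ord_recl coefXM [('X * u)`_0]coefXM /= rmorph0 mulr0
    mul0r add0r.
  by apply: eq_bigr => l _; rewrite coefXM /= hshift.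
Qed.

Lemma rms_lin_orthonormal (X : nat -> T -> R[i]) (u : {poly R[i]}) :
  (forall k, square_integrable (X k)) ->
  (forall k l, cexp (fun w => X k w * (X l w)^*) = (k == l)%:R) ->
  rms Pr (lin X u) ^+ 2 = \sum_(i < size u) sqn u`_i.
Proof.
move=> hX hXX; rewrite -cexp_msq; last exact: square_integrable_lin.
rewrite (@cexp_lin_mulJ _ _ (size u) (size u)) // raddf_sum; apply: eq_bigr => k _.
rewrite (bigD1 k) //= big1 ?addr0; last first.
  by move=> l lk; rewrite hXX eq_sym (inj_eq val_inj) (negbTE lk) mulr0.
by rewrite hXX eqxx mulr1 sqnE.
Qed.

(** The variance E|X - c|^2 = E|X|^2 - |c|^2 with c = EX is nonnegative. *)
Lemma sqn_cexp_le X : square_integrable X -> sqn (cexp X) <= rms Pr X ^+ 2.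
Proof.
move=> hX; set c := cexp X.
have iX := square_cintegrable hX.
have iXJ : cintegrable (fun w => (X w)^*).
  have := cintegrable_mulJ (square_integrable_cst Pr 1) hX.
  by rewrite (_ : (fun w => _) = (fun w => (X w)^*)) //; apply/funext => w; rewrite mul1r.
have ic : cintegrable (fun=> c * c^*) := square_cintegrable (square_integrable_cst Pr _).
have iXX := cintegrable_mulJ hX hX.
have hD := square_integrableB hX (square_integrable_cst Pr c).
have := sqr_ge0 (rms Pr (fun w => X w - c)); rewrite -(cexp_msq hD).
rewrite (@eq_cexp (fun w => (X w - c) * _) (fun w => X w * (X w)^* + (- c * (X w)^* + (- c^*
  * X w + c * c^*)))); last first.
  move=> w; case: (X w) (c) => x y [e f]; apply/eqP; rewrite eq_complex /=.
  by apply/andP; split; apply/eqP; ring.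
rewrite cexpD //; last by do 2! (apply: cintegrableD; first exact: cintegrableZ).
rewrite cexpD; [|exact: cintegrableZ|by apply: cintegrableD; first exact: cintegrableZ].
rewrite cexpD //; last exact: cintegrableZ.
rewrite (cexpZ (- c) iXJ) (cexpZ (- c^*) iX) (cexpJ iX) -/c (_ : cexp (fun=> c * c^*) = c *
  c^*).
  rewrite -(cexp_msq hX); case: (cexp (fun w => X w * (X w)^*)) => x y.
  by rewrite /sqn; case: (c) => e f /=; lra.
rewrite cexpE; case: (c * c^*) => x y; rewrite /Rintegral !integral_cst //=.
have -> : Pr [set: T] = 1%E by exact: probability_setT.
by rewrite !mule1.
Qed.

End Covariance.

(** * Mean square limits of sequences with geometrically small increments *)

Section Completeness.
Context {R : realType} {d : measure_display} {T : measurableType d}.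
Variable Pr : probability T R.
Local Notation square_integrable := (square_integrable Pr).
Local Notation msq := (msq Pr).
Local Notation rms := (rms Pr).

Lemma cvgn_le_series (x b : nat -> R) :
  (forall n, `|x n.+1 - x n| <= b n) -> cvgn (series b : nat -> R) -> cvgn x.
Proof.
move=> xb cb; have -> : x = (fun n => x 0%N + series (telescope x) n).
  by apply/funext => n; exact: eq_sum_telescope.
apply: is_cvgD; first exact: is_cvg_cst.
apply: normed_cvg; apply: series_le_cvg cb => // n.
  exact: normr_ge0.
exact: le_trans (normr_ge0 _) (xb n).
Qed.

Lemma normr_le_weighted_sqr (s x : R) : 0 < s -> `|x| <= s * x ^+ 2 + s^-1.
Proof.
move=> s0; have t0 : 0 < s^-1 by rewrite invr_gt0.
have := sqr_ge0 (s * `|x| - 1); rewrite -(pmulr_rge0 _ t0).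
have -> : s^-1 * (s * `|x| - 1) ^+ 2 = s * `|x| ^+ 2 * (s^-1 * s) - 2 * `|x| * (s^-1 * s) +
  s^-1 by ring.
by rewrite mulVf ?gt_eqF // -normrX (ger0_norm (sqr_ge0 x)); have := normr_ge0 x; lra.
Qed.

Lemma cvgn_weighted_sqn (z : nat -> R[i]) :
  cvgn (series (fun n => 2 ^+ n * sqn (z n.+1 - z n)) : nat -> R) ->
  cvgn (fun n => complex.Re (z n)) /\ cvgn (fun n => complex.Im (z n)).
Proof.
move=> cz.
have cb : cvgn (series (fun n => 2 ^+ n * sqn (z n.+1 - z n) + 2^-1 ^+ n) : nat -> R).
  rewrite (_ : series _ = (fun n => series (fun n => 2 ^+ n * sqn (z n.+1 - z n)) n + series
    (geometric 1 2^-1) n)).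
    by apply: is_cvgD => //; apply: is_cvg_geometric_series;
      rewrite ger0_norm ?invr_ge0 // invf_lt1 // ltr1n.
  apply/funext => n; rewrite /series /= -big_split /=; apply: eq_bigr => k _.
  by rewrite /geometric /= mul1r.
have b n (x : R) : x ^+ 2 <= sqn (z n.+1 - z n) ->
    `|x| <= 2 ^+ n * sqn (z n.+1 - z n) + 2^-1 ^+ n.
  move=> hx; have s0 : (0 : R) < 2 ^+ n by rewrite exprn_gt0.
  by rewrite (le_trans (normr_le_weighted_sqr x s0)) // exprVn lerD2r ler_pM2l.
split; apply: cvgn_le_series cb => n; apply: b.
  by rewrite -raddfB lerDl sqr_ge0.
by rewrite -raddfB lerDr sqr_ge0.
Qed.

(* A measurable limit; its value is junk (but finite) where S diverges. *)
Definition climit (S : nat -> T -> R[i]) (w : T) : R[i] :=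
  fine (limn_esup (fun n => (complex.Re (S n w))%:E)) +i*
  fine (limn_esup (fun n => (complex.Im (S n w))%:E)).

Lemma cmeasurable_climit (S : nat -> T -> R[i]) : (forall n, cmeasurable (S n)) ->
  cmeasurable (climit S).
Proof.
move=> mS; split.
  apply: (measurableT_comp (f := fine)) => //.
  apply: measurable_fun_limn_esup => n; apply/measurable_EFinP; exact: (mS n).1.
apply: (measurableT_comp (f := fine)) => //.
apply: measurable_fun_limn_esup => n; apply/measurable_EFinP; exact: (mS n).2.
Qed.

Lemma cvgn_fine_limn_esup (x : nat -> R) : cvgn x ->
  x @ \oo --> fine (limn_esup (fun n => (x n)%:E)).
Proof.
move=> cx; have h : (fun n => (x n)%:E) @ \oo --> (limn x)%:E.
  by apply: cvg_EFin => //; apply: nearW.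
by rewrite (cvg_limn_einf_sup h).2 /=.
Qed.

Lemma climit_cvg (S : nat -> T -> R[i]) w (z : R[i]) :
  cvgn (fun n => complex.Re (S n w)) -> cvgn (fun n => complex.Im (S n w)) ->
  (fun n => sqn (z - S n w)) @ \oo --> sqn (z - climit S w).
Proof.
move=> /cvgn_fine_limn_esup c1 /cvgn_fine_limn_esup c2.
have H (a l : R) (x : nat -> R) : x @ \oo --> l ->
    (fun n => (a - x n) * (a - x n)) @ \oo --> (a - l) * (a - l).
  by move=> xl; apply: cvgM; apply: cvgB => //; exact: cvg_cst.
have -> : sqn (z - climit S w) =
    (complex.Re z - complex.Re (climit S w)) * (complex.Re z - complex.Re (climit S w)) +
    (complex.Im z - complex.Im (climit S w)) * (complex.Im z - complex.Im (climit S w)).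
  by rewrite /sqn !raddfB /= !expr2.
have -> : (fun n => sqn (z - S n w)) = (fun n =>
    (complex.Re z - complex.Re (S n w)) * (complex.Re z - complex.Re (S n w)) +
    (complex.Im z - complex.Im (S n w)) * (complex.Im z - complex.Im (S n w))).
  by apply/funext => n; rewrite /sqn !raddfB /= !expr2.
by apply: cvgD; exact: H.
Qed.

Variables (S : nat -> T -> R[i]) (C : R).
Hypothesis hS : forall n, square_integrable (S n).
Hypothesis hC : forall n, rms (fun w => S n.+1 w - S n w) <= C * 2^-1 ^+ n.

Let dS n : square_integrable (fun w => S n.+1 w - S n w).
Proof. exact: square_integrableB. Qed.

(* The weights 2^n make the absolute increments summable as well, since
   |x| <= 2^n x^2 + 2^(-n). *)
Lemma ae_summable_increments : {ae Pr, forall w,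
  cvgn (series (fun n => 2 ^+ n * sqn (S n.+1 w - S n w)) : nat -> R)}.
Proof.
pose k n w := ((2 ^+ n * sqn (S n.+1 w - S n w))%R%:E : \bar R).
have mk n : measurable_fun [set: T] (k n).
  rewrite /k; under eq_fun do rewrite EFinM.
  by apply: measurable_funeM; apply: measurable_sqn; exact: (dS n).1.
have k0 n w : (0 <= k n w)%E by rewrite lee_fin mulr_ge0 ?exprn_ge0 ?sqn_ge0.
(* The bound 2^n (C 2^(-n))^2 = C^2 2^(-n) is written in the form that [epsilon_trick0] sums to 2
   C^2. *)
have ik n : (\int[Pr]_w k n w <= (2 * C ^+ 2 / (2 ^ n.+1)%:R)%:E)%E.
  under eq_integral do rewrite /k EFinM.
  rewrite ge0_integralZl_EFin ?exprn_ge0 //; first last.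
  - by apply: measurable_sqn; exact: (dS n).1.
  - by move=> w _; rewrite lee_fin sqn_ge0.
  rewrite -msqE msq_rms // -EFinM lee_fin.
  have h : rms (fun w => S n.+1 w - S n w) ^+ 2 <= (C * 2^-1 ^+ n) ^+ 2.
    by rewrite lerXn2r ?nnegrE ?rms_ge0 // (le_trans _ (hC n)) ?rms_ge0.
  have s0 : (0 : R) < 2 ^+ n by rewrite exprn_gt0.
  apply: (@le_trans _ _ (2 ^+ n * (C * 2^-1 ^+ n) ^+ 2)); first by rewrite ler_pM2l.
  rewrite natrX [2 ^+ n.+1]exprS exprVn le_eqVlt; apply/orP; left; apply/eqP.
  by move: s0; set y := 2 ^+ n => y0; field; rewrite gt_eqF.
have iF : Pr.-integrable [set: T] (fun w => \sum_(n <oo) k n w)%E.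
  apply/integrableP; split.
    by apply: ge0_emeasurable_sum => // n *; exact: k0.
  rewrite (@eq_integral _ _ _ _ _ (fun w => \sum_(n <oo) k n w)%E); last first.
    by move=> w _; rewrite gee0_abs //; apply: nneseries_ge0 => *; exact: k0.
  rewrite integral_nneseries // (@le_lt_trans _ _ (2 * C ^+ 2)%:E) ?ltry //.
  apply: le_trans (epsilon_trick0 xpredT _); last by rewrite mulr_ge0 ?sqr_ge0.
  by apply: lee_nneseries => // n *; apply: integral_ge0 => *; exact: k0.
have := integrable_ae measurableT iF; apply: filterS => w /(_ I) fw.
apply: nondecreasing_is_cvgn.
  apply/nondecreasing_seqP => n; rewrite /series /= big_nat_recr //= lerDl.
  by rewrite mulr_ge0 ?exprn_ge0 ?sqn_ge0.
exists (fine (\sum_(n <oo) k n w)%E) => _ [n _ <-].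
rewrite -lee_fin fineK // /series /= -sumEFin.
by apply: nneseries_lim_ge => *; exact: k0.
Qed.

Lemma rms_tail n m : rms (fun w => S n w - S (n + m)%N w) <= C * 2 * 2^-1 ^+ n.
Proof.
have C0 : 0 <= C by have := le_trans (rms_ge0 _ _) (hC 0); rewrite expr0 mulr1.
(* The induction on m needs the exact partial sum of the geometric series. *)
suff : rms (fun w => S n w - S (n + m)%N w) <= C * 2 * 2^-1 ^+ n * (1 - 2^-1 ^+ m).
  have s0 : 0 <= 2^-1 ^+ m :> R by rewrite exprn_ge0.
  have t0 : 0 <= C * 2 * 2^-1 ^+ n by rewrite !mulr_ge0 // exprn_ge0.
  by nra.
elim: m => [|m IH].
  rewrite addn0 expr0 subrr mulr0 (@eq_rms _ _ _ _ _ (fun=> 0)); last by move=> w;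
    rewrite subrr.
  by rewrite /rms msqE integral0_eq ?sqrtr0 // => w _; rewrite sqn0.
rewrite (@eq_rms _ _ _ _ _ (fun w => (S n w - S (n + m)%N w) - (S (n + m).+1 w - S (n + m)%N
  w))); last first.
  by move=> w; rewrite addnS opprB addrA subrK.
rewrite (le_trans (rmsB _ _)) //; first exact: square_integrableB.
have := hC (n + m); rewrite exprD [2^-1 ^+ m.+1]exprS.
have -> : C * 2 * 2^-1 ^+ n * (1 - 2^-1 * 2^-1 ^+ m) =
  C * 2 * 2^-1 ^+ n * (1 - 2^-1 ^+ m) + C * (2^-1 ^+ n * 2^-1 ^+ m) * (2 * 2^-1) by field.
by rewrite divff // mulr1; lra.
Qed.

(** Fatou's lemma in m for |S n - S (n + m)|^2: the integrals are bounded by [rms_tail], and almost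
    surely the integrands converge to |S n - [climit S]|^2. *)
Lemma msq_climit n : (msq (fun w => S n w - climit S w)%R
  <= ((C * 2 * 2^-1 ^+ n) ^+ 2)%:E)%E.
Proof.
have mS k : cmeasurable (S k) by exact: (hS k).1.
pose g m w := (sqn (S n w - S (n + m)%N w))%:E.
have mg m : measurable_fun [set: T] (g m).
  by apply: measurable_sqn; exact: (square_integrableB (hS n) (hS (n + m))).1.
have g0 m w : (0 <= g m w)%E by rewrite lee_fin sqn_ge0.
have B m : (\int[Pr]_w g m w <= ((C * 2 * 2^-1 ^+ n) ^+ 2)%:E)%E.
  rewrite -msqE msq_rms ?lee_fin; last exact: square_integrableB.
  rewrite lerXn2r ?nnegrE ?rms_ge0 ?rms_tail //.
  exact: le_trans (rms_ge0 _ _) (rms_tail n 0).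
rewrite msqE; apply: (@le_trans _ _ (\int[Pr]_w limn_einf (g^~ w))%E); last first.
  apply: (le_trans (fatou Pr measurableT mg (fun m w _ => g0 m w))).
  rewrite limn_einf_lim; apply: lime_le; first exact: is_cvg_einfs.
  apply: nearW => m; apply: (le_trans _ (B m)).
  by apply: ereal_inf_lbound; exists m => /=.
rewrite le_eqVlt; apply/orP; left; apply/eqP.
apply: ae_eq_integral => //.
- have [m1 m2] := cmeasurable_climit mS.
  apply: measurable_sqn; have := cmeasurableD (mS n) (cmeasurableM (cmeasurable_cst (-1))
    (cmeasurable_climit mS)).
  by rewrite (_ : (fun w => _) = (fun w => S n w - climit S w)) //; apply/funext => w;
    rewrite mulN1r.
- have -> : (fun w => limn_einf (g^~ w)) = (fun w => - limn_esup (-%E \o (g^~ w)))%E.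
    by apply/funext => w; rewrite limn_esupN oppeK.
  apply: (measurableT_comp (f := -%E)) => //; apply: measurable_fun_limn_esup => m.
  exact: (measurableT_comp (f := -%E)).
have := ae_summable_increments; apply: filterS => w /cvgn_weighted_sqn[c1 c2] _.
apply/esym; have h := climit_cvg (z := S n w) c1 c2.
have h' : (fun m => sqn (S n w - S (n + m)%N w)) @ \oo --> sqn (S n w - climit S w).
  rewrite (_ : (fun m => _) = [sequence sqn (S n w - S (m + n)%N w)]_m).
    by rewrite (cvg_shiftn n (fun m => sqn (S n w - S m w))).
  by apply/funext => m; rewrite addnC.
have h2 : g^~ w @ \oo --> (sqn (S n w - climit S w))%:E.
  by apply: cvg_EFin => //; exact: nearW.
by rewrite (cvg_limn_einf_sup h2).1.
Qed.

End Completeness.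

(** * The upper bound: one estimate that is good against every sequence *)

Section Game.
Context {R : realType} {d : measure_display} {T : measurableType d}.
Variables (Pr : probability T R) (N : nat) (a : nat -> R[i]) (P : R).
Implicit Types xi : int -> T -> R[i].
Local Notation square_integrable := (square_integrable Pr).
Local Notation cexp := (cexp Pr).
Local Notation msq := (msq Pr).
Local Notation rms := (rms Pr).
Local Notation Delta := (Delta Pr N a).
Local Notation F := (functional_poly N a).

(** For j = N the indices 0, ..., N are the values in the functional, and the index N+1+k is the
    observation at -(k+1). Hence linear combinations of observations are multiples of X^(N+1). *)
Definition backward xi (j : int) (k : nat) : T -> R[i] := xi (j - k%:Z).

Lemma functional_lin xi w : functional N a xi w = lin (backward xi N%:Z) F w.
Proof.
rewrite (@lin_widen _ _ _ _ N.+1) ?size_poly // /functional (reindex_inj rev_ord_inj) /=.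
apply: eq_bigr => k _; rewrite /functional_poly coef_poly ltn_ord subSS /backward.
by congr (_ * xi _ w); have := ltn_ord k; lia.
Qed.

Lemma past_comb_lin xi (c : seq R[i]) w :
  past_comb c xi w = lin (backward xi N%:Z) ('X^(N.+1) * Poly c) w.
Proof.
rewrite lin_shift /past_comb.
rewrite (big_ord_widen (size c) (fun k => (Poly c)`_k * backward xi N%:Z (N.+1 + k) w));
  last exact: size_Poly.
rewrite [RHS]big_mkcond; apply: eq_bigr => k _; rewrite coef_Poly.
have -> : backward xi N%:Z (N.+1 + k) w = xi (- (k.+1)%:Z) w.
  by rewrite /backward; congr (xi _ w); lia.
by case: ltnP => // hk; rewrite -coef_Poly nth_default ?mul0r.
Qed.

Lemma error_lin xi (c : seq R[i]) w :
  functional N a xi w - past_comb c xi w =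
  lin (backward xi N%:Z) (F - 'X^(N.+1) * Poly c) w.
Proof. by rewrite functional_lin past_comb_lin linB. Qed.

Lemma square_integrable_Xi xi : Xi Pr P xi -> forall j, square_integrable (xi j).
Proof. by case=> -[h _ _] _ _ j; exact: h. Qed.

Lemma cexp_mulJ_Xi xi : Xi Pr P xi -> forall n k l,
  cexp (fun w => xi (k + n) w * (xi k w)^*) = cexp (fun w => xi (l + n) w * (xi l w)^*).
Proof.
case=> -[_ _ hcov] h0 _ n k l; have := hcov n k l; rewrite /ccov !h0.
by under eq_fun do rewrite !subr0; under [in RHS]eq_fun do rewrite !subr0.
Qed.

Lemma backward_form xi : Xi Pr P xi -> shift_form (lin_form Pr (backward xi N%:Z)).
Proof.
move=> hxi; apply: lin_formP => [k|k l]; first exact: square_integrable_Xi.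
rewrite /backward.
have := cexp_mulJ_Xi hxi (l%:Z - k%:Z) (N%:Z - l.+1%:Z) (N%:Z - l%:Z).
have -> : N%:Z - l.+1%:Z + (l%:Z - k%:Z) = N%:Z - k.+1%:Z by lia.
by have -> : N%:Z - l%:Z + (l%:Z - k%:Z) = N%:Z - k%:Z by lia.
Qed.

(** The approximants [H n] come from the coefficients a alone, so their coefficient sequences form a
    rule independent of xi. For each xi their values have geometrically small increments, hence a
    mean square limit Y. *)
Lemma worst_error_le (nu : R) : 0 <= P -> largest_eigenvalue (Q N a) (nu ^+ 2) ->
  exists h, forall xi, Xi Pr P xi -> (Delta xi h <= (P * nu ^+ 2)%:E)%E.
Proof.
move=> P0 hnu.
(* Only the square of nu is prescribed and nu may be negative, so |nu| takes its place. *)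
have hF := functional_poly_contraction hnu; rewrite -(real_normK (num_real nu)) in hF.
have [H [K hHK]] := approximants (normr_ge0 nu) (size_poly N.+1 _) hF.
exists (fun n => H n : seq R[i]) => xi hxi.
have hB := hHK _ (backward_form hxi).
set B := lin_form _ _ in hB.
have hX k : square_integrable (backward xi N%:Z k) by exact: square_integrable_Xi.
pose S n := past_comb (H n) xi.
have SE n w : S n w = lin (backward xi N%:Z) ('X^(N.+1) * H n) w.
  by rewrite /S past_comb_lin polyseqK.
have hS n : square_integrable (S n).
  by rewrite (_ : S n = lin (backward xi N%:Z) ('X^(N.+1) * H n));
    [exact: square_integrable_lin|apply/funext].
have hA : square_integrable (functional N a xi).
  rewrite (_ : functional N a xi = lin (backward xi N%:Z) F);
    first exact: square_integrable_lin.
  by apply/funext => w; exact: functional_lin.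
(* The polynomial 1 stands for xi(N), so the class constraint bounds q^2 by P. *)
pose q := fnorm B 1.
have q0 : 0 <= q by exact: fnorm_ge0.
have qP : q ^+ 2 <= P.
  rewrite /q fnorm_lin // (@eq_rms _ _ _ _ _ (xi N%:Z)).
    rewrite -lee_fin -msq_rms; last exact: square_integrable_Xi.
    by case: hxi => _ _; exact.
  by move=> w; rewrite /lin size_poly1 big_ord1 coef1 mul1r /backward subr0.
have dS n : rms (fun w => S n.+1 w - S n w) <= (K * q) * 2^-1 ^+ n.
  rewrite (@eq_rms _ _ _ _ _ (lin (backward xi N%:Z) ('X^(N.+1) * (H n.+1 - H n)))).
    by rewrite -fnorm_lin // mulrAC; exact: (hB n).2.
  by move=> w; rewrite !SE mulrBr linB.
have eS n : rms (fun w => functional N a xi w - S n w) <= (`|nu| + K * 2^-1 ^+ n) * q.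
  rewrite (@eq_rms _ _ _ _ _ (lin (backward xi N%:Z) (F - 'X^(N.+1) * H n))).
    by rewrite -fnorm_lin //; exact: (hB n).1.
  by move=> w; rewrite error_lin polyseqK.
pose Y := climit S.
have hY := msq_climit hS dS.
have mY : cmeasurable Y by apply: cmeasurable_climit => n; exact: (hS n).1.
have g0 : (fun n => (2^-1 : R) ^+ n) @ \oo --> 0.
  by apply: cvg_expr; rewrite ger0_norm ?invr_ge0 // invf_lt1 // ltr1n.
have SY n : square_integrable (fun w => S n w - Y w).
  split; last by rewrite (le_lt_trans (hY n)) // ltry.
  have := cmeasurableD (hS n).1 (cmeasurableM (cmeasurable_cst (-1)) mY).
  by under eq_fun do rewrite mulN1r.
have FY : square_integrable (fun w => functional N a xi w - Y w).
  rewrite (_ : (fun w => _) = (fun w => (functional N a xi w - S 0%N w) + (S 0%N w - Y w))).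
    by apply: square_integrableD => //; exact: square_integrableB.
  by apply/funext => w; rewrite addrA subrK.
apply: (@le_trans _ _ (msq (fun w => functional N a xi w - Y w))).
  apply: ereal_inf_lbound; exists Y => //; split=> //.
  apply: (@squeeze_cvge _ _ _ _ (fun=> 0%E) _ (fun n => ((K * q * 2 * 2^-1 ^+ n) ^+ 2)%:E)).
  - by apply: nearW => n; rewrite msq_ge0 /=; exact: hY.
  - exact: cvg_cst.
  apply: cvg_EFin; first exact: nearW.
  have -> : (0 : R) = (K * q * 2 * 0) * (K * q * 2 * 0) by rewrite mulr0 mul0r.
  by apply: cvgM; apply: cvgMr.
rewrite msq_rms // lee_fin.
suff h : rms (fun w => functional N a xi w - Y w) <= `|nu| * q.
  apply: (@le_trans _ _ ((`|nu| * q) ^+ 2)).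
    by rewrite lerXn2r ?nnegrE ?rms_ge0 ?mulr_ge0.
  by rewrite exprMn real_normK ?num_real // mulrC ler_wpM2r ?sqr_ge0.
(* The error of [S n] contributes one K and the distance from [S n] to Y contributes two; absolute
   values appear because the sign of K is unknown. *)
have hn n : rms (fun w => functional N a xi w - Y w) <= `|nu| * q + (3 * (`|K| * q)) * 2^-1
  ^+ n.
  rewrite (@eq_rms _ _ _ _ _ (fun w => (functional N a xi w - S n w) + (S n w - Y w)));
    last first.
    by move=> w; rewrite addrA subrK.
  apply: (le_trans (rmsD _ _)) => //; first exact: square_integrableB.
  have : rms (fun w => S n w - Y w) <= `|K| * q * 2 * 2^-1 ^+ n.
    have := hY n; rewrite msq_rms // lee_fin => h.
    rewrite -[leLHS]ger0_norm ?rms_ge0 // -sqrtr_sqr.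
    have -> : `|K| * q * 2 * 2^-1 ^+ n = Num.sqrt ((K * q * 2 * 2^-1 ^+ n) ^+ 2).
      by rewrite sqrtr_sqr !normrM (ger0_norm q0) [`|2|]ger0_norm // [`|_ ^+ n|]ger0_norm //
        exprn_ge0.
    by rewrite ler_wsqrtr.
  have : K * (2^-1 ^+ n * q) <= `|K| * (2^-1 ^+ n * q).
    by rewrite ler_wpM2r ?ler_norm // mulr_ge0 ?exprn_ge0.
  by have := eS n; lra.
have : (fun n => `|nu| * q + (3 * (`|K| * q)) * 2^-1 ^+ n) @ \oo --> `|nu| * q.
  rewrite -[X in _ --> X]addr0 -[X in _ + X](mulr0 (3 * (`|K| * q))).
  by apply: cvgD; [exact: cvg_cst|exact: cvgMr].
move=> h; rewrite -(cvg_lim (@Rhausdorff R) h); apply: limr_ge; first exact: cvgP h.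
by apply: nearW => n; exact: hn.
Qed.

End Game.

(** * The lower bound: moving averages built from eigenvectors *)

Section MovingAverage.
Context {R : realType} {d : measure_display} {T : measurableType d}.
Variables (Pr : probability T R) (eps : int -> T -> R[i]).
Hypothesis heps : stationary_orthonormal Pr eps.
Local Notation square_integrable := (square_integrable Pr).
Local Notation cexp := (cexp Pr).
Local Notation msq := (msq Pr).
Local Notation rms := (rms Pr).

Lemma square_integrable_eps j : square_integrable (eps j).
Proof. by case: heps => -[h _ _] _; exact: h. Qed.

(* The mean of n orthonormal variables has squared norm 1/n, which bounds the
   squared modulus of their common expectation. *)
Lemma cexp_eps j : cexp (eps j) = 0.
Proof.
case: heps => -[_ hm _] hcov.
apply/eqP; rewrite -sqn_eq0; apply/negP => /negP m0.
have mp : 0 < sqn (cexp (eps j)) by rewrite lt_def m0 sqn_ge0.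
set n := Num.bound (sqn (cexp (eps j)))^-1.
have hn : 1 < sqn (cexp (eps j)) * n%:R.
  rewrite mulrC -ltr_pdivrMr // mul1r.
  by apply: archi_boundP; rewrite invr_ge0 ltW.
pose X (k : nat) := eps k%:Z.
have hX k : square_integrable (X k) by exact: square_integrable_eps.
have hXX k l : cexp (fun w => X k w * (X l w)^*) = (k == l)%:R by rewrite hcov.
pose u : {poly R[i]} := \poly_(k < n) 1.
have su : (size u <= n)%N by exact: size_poly.
have := sqn_cexp_le (square_integrable_lin hX u).
rewrite rms_lin_orthonormal //.
have -> : cexp (lin X u) = n%:R * cexp (eps j).
  rewrite (@eq_cexp _ _ _ _ _ (fun w => \sum_(k < n) X k w)); last first.
    by move=> w; rewrite (lin_widen _ _ su); apply: eq_bigr => k _;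
      rewrite coef_poly ltn_ord mul1r.
  rewrite cexp_sum; last by move=> k; exact: square_cintegrable.
  rewrite (eq_bigr (fun=> cexp (eps j))); last by move=> k _; exact: hm.
  by rewrite sumr_const card_ord mulr_natl.
have -> : (n%:R : R[i]) = (n%:R : R)%:C by rewrite rmorph_nat.
have n0 : (0 : R) < n%:R.
  by rewrite -(pmulr_rgt0 _ mp) (lt_trans _ hn).
(* With m the common mean, n^2 |m|^2 <= n would contradict the choice of n, which gives n |m|^2 >
   1. *)
rewrite sqnM sqn_real leNgt => /negP; apply.
apply: (@le_lt_trans _ _ (n%:R : R)); last by rewrite expr2 -mulrA ltr_pMr // mulrC.
apply: (@le_trans _ _ (\sum_(i < size u) 1)).
  apply: ler_sum => i _; rewrite coef_poly; case: ifP; rewrite ?sqn1 ?sqn0 //.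
by rewrite sumr_const card_ord ler_nat.
Qed.

Variables (N : nat) (phi : 'rV[R[i]]_N.+1).
Let xi0 := moving_average phi eps.

Lemma square_integrable_backward j k : square_integrable (backward eps j k).
Proof. exact: square_integrable_eps. Qed.

Lemma cexp_backward j k l :
  cexp (fun w => backward eps j k w * (backward eps j l w)^*) = (k == l)%:R.
Proof.
case: heps => _ h; rewrite /backward h; congr (nat_of_bool _)%:R.
by rewrite (inj_eq (addrI _)) eqr_opp.
Qed.

Lemma moving_average_lin j w : xi0 j w = lin (backward eps j) (rVpoly phi) w.
Proof.
rewrite (@lin_widen _ _ _ _ N.+1) ?size_poly //.
by apply: eq_bigr => k _; rewrite coef_rVpoly_ord.
Qed.

Lemma square_integrable_moving_average j : square_integrable (xi0 j).
Proof.
rewrite (_ : xi0 j = lin (backward eps j) (rVpoly phi)).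
  by apply: square_integrable_lin => k; exact: square_integrable_backward.
by apply/funext => w; exact: moving_average_lin.
Qed.

(** Filtering becomes multiplication by the polynomial Phi of the coefficients phi, which reduces
    errors to coefficients over an orthonormal sequence. *)
Lemma backward_moving_average_lin j u w :
  lin (backward xi0 j) u w = lin (backward eps j) (u * rVpoly phi) w.
Proof.
rewrite -{2}[u]coefK poly_def mulr_suml.
under eq_bigr do rewrite -scalerAl.
rewrite lin_sumZ /lin; apply: eq_bigr => k _; congr (_ * _).
rewrite -[RHS]/(lin _ _ _) lin_shift /backward moving_average_lin /lin.
by apply: eq_bigr => l _; congr (_ * eps _ w); lia.
Qed.

Lemma msq_moving_average j : msq (xi0 j) = (\sum_i sqn (phi 0 i))%:E.
Proof.
rewrite msq_rms; last exact: square_integrable_moving_average.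
rewrite (@eq_rms _ _ _ _ _ (lin (backward eps j) (rVpoly phi))); last first.
  by move=> w; exact: moving_average_lin.
rewrite rms_lin_orthonormal; first last.
- exact: cexp_backward.
- exact: square_integrable_backward.
congr EFin.
have -> : \sum_i sqn (phi 0 i) = \sum_(i < N.+1) sqn (rVpoly phi)`_i.
  by apply: eq_bigr => i _; rewrite coef_rVpoly_ord.
rewrite (big_ord_widen N.+1 (fun i => sqn (rVpoly phi)`_i)) ?size_poly // big_mkcond.
by apply: eq_bigr => i _; case: ltnP => // hi; rewrite nth_default // sqn0.
Qed.

Lemma cexp_moving_average j : cexp (xi0 j) = 0.
Proof.
have iE k : cintegrable Pr (eps k) by apply: square_cintegrable; exact: square_integrable_eps.
rewrite cexp_sum => [|k]; last exact: cintegrableZ.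
by rewrite big1 // => k _; rewrite cexpZ // cexp_eps mulr0.
Qed.

Lemma moving_average_Xi (P : R) :
  (forall j, msq (xi0 j) = P%:E) -> Xi Pr P xi0.
Proof.
move=> hP; split=> [|j|j]; [|exact: cexp_moving_average|by rewrite hP].
split=> [j|j k|n k l]; first exact: square_integrable_moving_average.
  by rewrite !cexp_moving_average.
rewrite /ccov !cexp_moving_average.
have E m : cexp (fun w => (xi0 (m + n) w - 0) * (xi0 m w - 0)^*) =
    cexp (fun w => lin (backward eps (m + n)) (rVpoly phi) w * (lin (backward eps m) (rVpoly
      phi) w)^*).
  by apply: eq_cexp => w; rewrite !subr0 !moving_average_lin.
have sE m k' : square_integrable (backward eps m k') := square_integrable_backward m k'.
rewrite !E !(cexp_lin_mulJ (sE _) (sE _) (leqnn _) (leqnn _)).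
(* The orthonormality indicator compares m + n - p with m - q, and the base time m cancels. *)
apply: eq_bigr => p _; apply: eq_bigr => q _; congr (_ * _).
case: heps => _ h; rewrite /backward !h; congr (nat_of_bool _)%:R.
by apply/eqP/eqP; lia.
Qed.

Lemma moving_average_error_ge (a : nat -> R[i]) (P nu : R) (h : linear_estimate R) :
  (phi <= eigenspace (Q N a) (nu ^+ 2)%:C)%MS ->
  (forall j, msq (xi0 j) = P%:E) ->
  ((P * nu ^+ 2)%:E <= Delta Pr N a xi0 h)%E.
Proof.
(* A rule without a mean square limit at this sequence has error +oo, so only an actual limit Y has
   to be treated. *)
move=> hphi hP; apply: le_ereal_inf_tmp => _ [Y [mY cY] <-].
have P0 : 0 <= P by rewrite -lee_fin -(hP 0) msq_ge0.
have hX0 k : square_integrable (backward xi0 N%:Z k) by exact: square_integrable_moving_average.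
have sL u : square_integrable (lin (backward xi0 N%:Z) u) by exact: square_integrable_lin.
pose S n := past_comb (h n) xi0.
have hS n : square_integrable (S n).
  by rewrite (_ : S n = lin (backward xi0 N%:Z) ('X^(N.+1) * Poly (h n))) //;
    apply/funext => w; exact: past_comb_lin.
have hA : square_integrable (functional N a xi0).
  by rewrite (_ : functional N a xi0 = lin (backward xi0 N%:Z) (functional_poly N a)) //;
    apply/funext => w; exact: functional_lin.
(* The observations alter only coefficients of degree above N, so the first N+1 coefficients of the
   error are those of F Phi; the remaining ones can only increase the norm. *)
have error_ge n : P * nu ^+ 2 <= rms (fun w => functional N a xi0 w - S n w) ^+ 2.
  set v := (functional_poly N a - 'X^(N.+1) * Poly (h n)) * rVpoly phi.
  rewrite (@eq_rms _ _ _ _ _ (lin (backward eps N%:Z) v)); last first.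
    by move=> w; rewrite error_lin backward_moving_average_lin.
  rewrite rms_lin_orthonormal; first last.
  - exact: cexp_backward.
  - exact: square_integrable_backward.
  have -> : P * nu ^+ 2 = sqnorm (@coef_form R N.+1) v.
    rewrite (@sqnorm_coef_congr _ _ _ (functional_poly N a * rVpoly phi)); last first.
      by rewrite /v mulrBl addrAC subrr sub0r dvdpNr -mulrA dvdp_mulr.
    rewrite (functional_poly_eigen hphi) mulrC; congr (_ * _).
    by have := hP 0; rewrite msq_moving_average => -[].
  rewrite sqnorm_coef; pose n' := maxn N.+1 (size v).
  have -> : \sum_(i < size v) sqn v`_i = \sum_(i < n') sqn v`_i.
    rewrite (big_ord_widen n' (fun i => sqn v`_i)) ?leq_maxr // big_mkcond.
    by apply: eq_bigr => i _; case: ltnP => // hi; rewrite nth_default // sqn0.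
  rewrite (big_ord_widen n' (fun i => sqn v`_i)) ?leq_maxl // big_mkcond.
  by apply: ler_sum => i _; case: ifP => // _; exact: sqn_ge0.
have mSY n : cmeasurable (fun w => S n w - Y w).
  have := cmeasurableD (hS n).1 (cmeasurableM (cmeasurable_cst (-1)) mY).
  by under eq_fun do rewrite mulN1r.
(* The bound for finite combinations passes to Y through an [S n] at mean square distance at most
   e. *)
have close e : 0 < e -> exists n, square_integrable (fun w => S n w - Y w) /\
    rms (fun w => S n w - Y w) <= e.
  move=> e0; have e2 : (0 < (e ^+ 2)%:E)%E by rewrite lte_fin exprn_gt0.
  have [n _ /(_ n (leqnn n)) /= hn] : \forall n \near \oo, (msq (fun w => S n w - Y w)%R <
    (e ^+ 2)%:E)%E.
    apply: (cY [set y | (y < (e ^+ 2)%:E)%E]); apply: open_nbhs_nbhs; split=> //.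
    exact: open_ereal_lt_ereal.
  have sSY : square_integrable (fun w => S n w - Y w).
    by split=> //; rewrite (lt_trans hn) // ltry.
  exists n; split=> //; move: hn; rewrite msq_rms // lte_fin => hn.
  by rewrite -ler_sqr ?nnegrE ?rms_ge0 ?ltW.
have sFY : square_integrable (fun w => functional N a xi0 w - Y w).
  have [n [sn _]] := close 1 ltr01.
  rewrite (_ : (fun w => _) = (fun w => (functional N a xi0 w - S n w) + (S n w - Y w))).
    by apply: square_integrableD => //; exact: square_integrableB.
  by apply/funext => w; rewrite addrA subrK.
rewrite msq_rms // lee_fin.
have t0 : 0 <= P * nu ^+ 2 by rewrite mulr_ge0 ?sqr_ge0.
rewrite -(sqr_sqrtr t0) lerXn2r ?nnegrE ?rms_ge0 ?sqrtr_ge0 //.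
apply/ler_addgt0Pr => e /close [n [sn hn]].
apply: (@le_trans _ _ (rms (fun w => functional N a xi0 w - S n w))).
  by rewrite -[leRHS]ger0_norm ?rms_ge0 // -sqrtr_sqr ler_wsqrtr.
rewrite (@eq_rms _ _ _ _ _ (fun w => (functional N a xi0 w - Y w) - (S n w - Y w))); last first.
  by move=> w; rewrite opprB addrA subrK.
by apply: (le_trans (rmsB _ _)) => //; rewrite lerD2l.
Qed.

End MovingAverage.

(** * Existence of the extremal sequence and the value of the game *)

Lemma exists_moving_average (R : realType) (d : measure_display) (T : measurableType d)
    (Pr : probability T R) (eps : int -> T -> R[i])
    (N : nat) (a : nat -> R[i]) (P x : R) :
  stationary_orthonormal Pr eps -> 0 < P -> eigenvalue (Q N a) x%:C ->
  exists phi : 'rV[R[i]]_N.+1, determined_by_eigenvector Pr a x P eps phi.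
Proof.
move=> heps hP /eigenvalueP[v vQ v0].
have s0 : 0 < \sum_i sqn (v 0 i).
  rewrite lt_def sumr_ge0 ?andbT => [|i _]; last exact: sqn_ge0.
  apply: contraNneq v0 => /eqP; rewrite psumr_eq0 => [/allP h|i _]; last exact: sqn_ge0.
  apply/eqP/rowP => i; apply/eqP; rewrite mxE -sqn_eq0.
  by have := h i; rewrite mem_index_enum => /(_ isT).
(* The variance of the moving average is the squared norm of its coefficients; this factor makes it
   P. *)
exists ((Num.sqrt (P / \sum_i sqn (v 0 i)))%:C *: v); split.
  by apply: scalemx_sub; apply/eigenspaceP.
move=> j; rewrite msq_moving_average //; congr EFin.
under eq_bigr do rewrite mxE sqnM sqn_real sqr_sqrtr ?divr_ge0 ?(ltW hP) ?(ltW s0) //.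
by rewrite -mulr_sumr divfK // gt_eqF.
Qed.

Theorem theorem1 (R : realType) (d : measure_display) (T : measurableType d)
    (Pr : probability T R) (eps : int -> T -> R[i])
    (heps : stationary_orthonormal Pr eps)
    (N : nat) (a : nat -> R[i]) (P : R) (hP : 0 < P)
    (nu : R) (hnu : largest_eigenvalue (Q N a) (nu ^+ 2)) :
  [/\ exists xi0 h0,
        saddle_point (Delta Pr N a) (Xi Pr P) (Lambda R) xi0 h0,
      is_minimum [set worst_error (Delta Pr N a) (Xi Pr P) h | h in Lambda R]
        (P * nu ^+ 2)%:E,
      is_maximum [set least_error (Delta Pr N a) (Lambda R) xi | xi in Xi Pr P]
        (P * nu ^+ 2)%:E &
      forall phi : 'rV[R[i]]_N.+1,
        determined_by_eigenvector Pr a (nu ^+ 2) P eps phi ->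
        least_favourable (Delta Pr N a) (Xi Pr P) (Lambda R)
          (moving_average phi eps)].
Proof.
have [h0 hle] := worst_error_le Pr (ltW hP) hnu.
have Xi0 (phi : 'rV[R[i]]_N.+1) : determined_by_eigenvector Pr a (nu ^+ 2) P eps phi ->
    Xi Pr P (moving_average phi eps) by case=> _; exact: (moving_average_Xi heps).
have hge (phi : 'rV[R[i]]_N.+1) h : determined_by_eigenvector Pr a (nu ^+ 2) P eps phi ->
    ((P * nu ^+ 2)%:E <= Delta Pr N a (moving_average phi eps) h)%E.
  by case=> ephi hphi; exact: (moving_average_error_ge heps).
have leastE (phi : 'rV[R[i]]_N.+1) : determined_by_eigenvector Pr a (nu ^+ 2) P eps phi ->
    least_error (Delta Pr N a) (Lambda R) (moving_average phi eps) = (P * nu ^+ 2)%:E.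
  move=> hphi; apply/eqP; rewrite eq_le; apply/andP; split.
    by apply: (le_trans _ (hle _ (Xi0 _ hphi))); apply: ereal_inf_lbound; exists h0.
  by apply: le_ereal_inf_tmp => _ [h _ <-]; exact: hge.
have least_le xi : Xi Pr P xi ->
    (least_error (Delta Pr N a) (Lambda R) xi <= (P * nu ^+ 2)%:E)%E.
  by move=> hxi; apply: (le_trans _ (hle _ hxi)); apply: ereal_inf_lbound; exists h0.
have [phi hphi] := exists_moving_average heps hP hnu.1.
have worst_ge h : ((P * nu ^+ 2)%:E <= worst_error (Delta Pr N a) (Xi Pr P) h)%E.
  apply: (le_trans (hge phi h hphi)); apply: ereal_sup_ubound.
  by exists (moving_average phi eps) => //; exact: Xi0.
split.
(* Both saddle inequalities pass through P nu^2: [hle] bounds the error of h0 from above for every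
   sequence, and [hge] bounds the error at the moving average from below for every rule. *)
- exists (moving_average phi eps), h0; split=> // [|xi hxi|h _]; first exact: Xi0.
    by rewrite (le_trans (hle _ hxi)) // hge.
  by rewrite (le_trans (hle _ (Xi0 _ hphi))) // hge.
- split; last by move=> _ [h _ <-].
  exists h0 => //; apply/eqP; rewrite eq_le worst_ge andbT.
  by apply: ge_ereal_sup => _ [xi hxi <-]; exact: hle.
- split; last by move=> _ [xi hxi <-]; exact: least_le.
  by exists (moving_average phi eps); [exact: Xi0 | exact: leastE].
move=> psi hpsi; split; first exact: Xi0.
split; first by exists (moving_average psi eps) => //; exact: Xi0.
by move=> _ [xi hxi <-]; rewrite leastE //; exact: least_le.
Qed.
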